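(* Let either $\theta=0$ and $n\in(0,3/2)$, or $\theta>0$ and $n\in(0,3)$. There exists a connecting orbit between $\mathcal B_0^\theta$ and $\mathcal B_1$. If $\theta=0$ and $H>0$ for all $x\in(0,1]$, the orbit is unique and monotone, i.e. $H'>0$ for $x\in(0,1)$.
   Context: Consider the autonomous first-order system in $\mathbb R^4$ with phase-space variables $(x,H,H',H'')$, $$\frac{d}{d\tau}\begin{pmatrix}x\\H\\H'\\H''\end{pmatrix}=\begin{pmatrix}1\\H'\\H''\\H^{1-n}(x-1)\end{pmatrix},$$ which is equivalent to the third-order equation $H^{n-1}\frac{d^3H}{dx^3}=-1+x$ (for $H>0$). Let $$\mathcal B_0^\theta=\{x=0,\ H=0,\ H'=\theta\},\qquad \mathcal B_1=\{x=1,\ H'=0\}$$ be the boundary manifolds. A connecting orbit between $\mathcal B_0^\theta$ and $\mathcal B_1$ is a trajectory of the system, parametrized by $x\in(0,1]$, with $(H,H')\to(0,\theta)$ as $x\searrow0$ and $H'=0$ at $x=1$; thus connecting orbits correspond to solutions of the boundary-value problem $H^{n-1}\frac{d^3H}{dx^3}=-1+x$ on $(0,1)$, $(H,\frac{dH}{dx})=(0,\theta)$ at $x=0$, $\frac{dH}{dx}=0$ at $x=1$. *)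

(* Defs.v *)
From HB Require Import structures.
From mathcomp Require Import all_boot all_order all_algebra.
From mathcomp Require Import all_classical all_reals all_analysis.
Set Implicit Arguments.
Unset Strict Implicit.
Unset Printing Implicit Defensive.
Import Order.TTheory GRing.Theory Num.Theory.
Import numFieldNormedType.Exports.
Local Open Scope classical_set_scope.
Local Open Scope ring_scope.

(* Points of the phase space R^4 are columns (x, H, H', H''), whose last three
   entries are independent coordinates; the numerals below are indices in 'I_4. *)
Definition coord_x (R : realType) (u : 'cV[R]_4) : R := u 0 0.
Definition coord_H (R : realType) (u : 'cV[R]_4) : R := u 1 0.
Definition coord_dH (R : realType) (u : 'cV[R]_4) : R := u 2 0.
Definition coord_ddH (R : realType) (u : 'cV[R]_4) : R := u 3 0.

(* The real power [`^] is the usual one only for a positive base; trajectories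
   are therefore required below to have H > 0. *)
Definition vector_field (R : realType) (n : R) (u : 'cV[R]_4) : 'cV[R]_4 :=
  \col_(i < 4) [:: 1; coord_dH u; coord_ddH u;
                   coord_H u `^ (1 - n) * (coord_x u - 1)]`_i.

(* On the half-open interval ]0, 1] the derivative at the endpoint 1 is the
   left derivative. Positivity is demanded on ]0, 1[, where the equation
   H^(n-1) H''' = x - 1 is posed: without it H = 0 would be an equilibrium in H
   for n < 1. If H vanished at the endpoint 1, the last component of the field
   would be 0 there, because of the factor x - 1. *)
Definition trajectory (R : realType) (n : R) (g : R -> 'cV[R]_4) : Prop :=
  [/\ forall t : R, 0 < t < 1 -> 0 < coord_H (g t),
      forall t : R, 0 < t < 1 -> is_derive t 1 g (vector_field n (g t)) &
      h^-1 *: (g (1 + h) - g 1) @[h --> 0^'-] --> vector_field n (g 1)].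

Definition parametrized_by_x (R : realType) (g : R -> 'cV[R]_4) : Prop :=
  forall t : R, 0 < t <= 1 -> coord_x (g t) = t.

Definition tends_to_B0 (R : realType) (theta : R) (g : R -> 'cV[R]_4) : Prop :=
  [/\ coord_x (g t) @[t --> 0^'+] --> (0 : R),
      coord_H (g t) @[t --> 0^'+] --> (0 : R) &
      coord_dH (g t) @[t --> 0^'+] --> theta].

Definition B1 (R : realType) : set 'cV[R]_4 :=
  [set u | coord_x u = 1 /\ coord_dH u = 0].

(* Only the values of g on ]0, 1] are relevant. *)
Definition connecting_orbit (R : realType) (n theta : R)
    (g : R -> 'cV[R]_4) : Prop :=
  [/\ trajectory n g, parametrized_by_x g, tends_to_B0 theta g & B1 (g 1)].

Definition positive_orbit (R : realType) (g : R -> 'cV[R]_4) : Prop :=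
  forall t : R, 0 < t <= 1 -> 0 < coord_H (g t).

(* Main.v *)
Require Import Defs.
From HB Require Import structures.
From mathcomp Require Import all_boot all_order all_algebra.
From mathcomp Require Import all_classical all_reals all_analysis.
From mathcomp Require Import ring lra.
Import Order.TTheory GRing.Theory Num.Theory.
Import numFieldNormedType.Exports.
Local Open Scope classical_set_scope.
Local Open Scope ring_scope.
Set Implicit Arguments.
Unset Strict Implicit.

(** Write v = H', q = H''. Then v'' = -(1 - x) H^(1 - n) <= 0, so v is concave,
    and v vanishes at both ends when theta = 0; this gives monotonicity, and by
    comparison an order between solutions whose right-hand sides are ordered.

    Uniqueness (theta = 0): every solution lies between two multiples of x^2, so
    the least M >= 1 with H1 <= M H2 and H2 <= M H1 exists; comparison improves M
    to M^|1 - n|, and |1 - n| < 1 forces M = 1.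

    Existence: H^(1 - n) is replaced by its value at H clamped between two
    barriers, so that the right-hand side F(x, H) is dominated by an integrable
    singularity at 0. The problem is then discretized by concentrating the
    right-hand side at the nodes of a uniform mesh. The discrete equations are
    triangular once c = H''(0) is given, and c is found by the intermediate value
    theorem. The discrete solutions converge pointwise along an ultrafilter, and
    Taylor estimates that are uniform in the mesh pass the derivatives to the
    limit. Finally the limit is shown to stay between the barriers. *)

(** * Comparison for concave functions *)

Lemma mvt_oo (R : realType) (a b : R) (u q : R -> R) :
  (forall x : R, a < x < b -> is_derive x 1 u (q x)) ->
  forall x y : R, a < x -> x < y -> y < b ->
  exists2 c, x < c < y & u y - u x = q c * (y - x).
Proof.
move=> du x y ax xy yb.
have [||c] := @MVT R u q x y xy.
- by move=> z; rewrite in_itv/= => /andP[xz zy]; apply: du; lra.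
- apply: derivable_within_continuous => z; rewrite in_itv/= => /andP[xz zy].
  by have [] : is_derive z 1 u (q z) by apply: du; lra.
- by rewrite in_itv/= => h; exists c.
Qed.

Lemma nonincreasing_oo (R : realType) (a b : R) (u q : R -> R) :
  (forall x : R, a < x < b -> is_derive x 1 u (q x)) ->
  (forall x : R, a < x < b -> q x <= 0) ->
  forall x y : R, a < x -> x <= y -> y < b -> u y <= u x.
Proof.
move=> du q0 x y ax; rewrite le_eqVlt => /predU1P[-> //|xy] yb.
have [c cxy e] := mvt_oo du ax xy yb.
have : q c <= 0 by apply: q0; lra.
by nra.
Qed.

Lemma nondecreasing_oo (R : realType) (a b : R) (u q : R -> R) :
  (forall x : R, a < x < b -> is_derive x 1 u (q x)) ->
  (forall x : R, a < x < b -> 0 <= q x) ->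
  forall x y : R, a < x -> x <= y -> y < b -> u x <= u y.
Proof.
move=> du q0 x y ax; rewrite le_eqVlt => /predU1P[-> //|xy] yb.
have [c cxy e] := mvt_oo du ax xy yb.
have : 0 <= q c by apply: q0; lra.
by nra.
Qed.

Lemma nondecreasing_ge_lim (R : realType) (b l : R) (u : R -> R) :
  (forall x y : R, 0 < x -> x <= y -> y < b -> u x <= u y) ->
  u x @[x --> 0^'+] --> l -> forall x : R, 0 < x < b -> l <= u x.
Proof.
move=> mu ul x /andP[x0 xb].
apply: (cvgr_to_le ul).
near=> s; apply: mu => //.
by near: s; exact: nbhs_right_le.
Unshelve. all: by end_near. Qed.

(** At a negative value, the end limits give larger values on both sides. The chords then have
    negative slope on the left and positive slope on the right, which contradicts the monotonicity
    of the derivative. Only limits at the ends are assumed, so singular behaviour at 0 is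
    allowed. *)
Lemma concave_ge0 (R : realType) (b l r : R) (u q : R -> R) :
  (forall x : R, 0 < x < b -> is_derive x 1 u (q x)) ->
  (forall x y : R, 0 < x -> x <= y -> y < b -> q y <= q x) ->
  u x @[x --> 0^'+] --> l -> 0 <= l -> u x @[x --> b^'-] --> r -> 0 <= r ->
  forall x : R, 0 < x < b -> 0 <= u x.
Proof.
move=> du qn ul l0 ur r0 x /andP[x0 xb]; rewrite leNgt; apply/negP => ux.
have [s [s0 sx us]] : exists s, [/\ 0 < s, s < x & u x < u s].
  suff [s] : exists s, [set s | [/\ 0 < s, s < x & u x < u s]] s by exists s.
  apply: (@filter_ex _ 0^'+); near=> s; split => //.
  by near: s; apply: (cvgr_gt l) => //; exact: lt_le_trans ux _.
have [t [xt tb ut]] : exists t, [/\ x < t, t < b & u x < u t].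
  suff [t] : exists t, [set t | [/\ x < t, t < b & u x < u t]] t by exists t.
  apply: (@filter_ex _ b^'-); near=> z; split => //.
  by near: z; apply: (cvgr_gt r) => //; exact: lt_le_trans ux _.
have [c cb ec] := mvt_oo du s0 sx xb.
have [d db ed] := mvt_oo du x0 xt tb.
have : q d <= q c by apply: qn; lra.
have : q c < 0 by nra.
have : 0 < q d by nra.
lra.
Unshelve. all: by end_near. Qed.

Lemma is_derive_lin (R : realType) (f g : R -> R) (x a b j k : R) :
  is_derive x 1 f a -> is_derive x 1 g b ->
  is_derive x 1 (fun t => j * f t + k * g t) (j * a + k * b).
Proof. by move=> fa gb; exact: is_deriveD (is_deriveZ _ fa) (is_deriveZ _ gb). Qed.

Lemma is_derive_cvg (R : realType) (f : R -> R) (x a : R) :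
  is_derive x 1 f a -> f t @[t --> x] --> f x.
Proof. by move=> [df _]; exact/differentiable_continuous/derivable1_diffP. Qed.

Lemma is_derive_ext (R : realType) (f g : R -> R) (x a b : R) :
  f = g -> a = b -> is_derive x 1 f a -> is_derive x 1 g b.
Proof. by move=> -> ->. Qed.

Lemma is_derive_monomial (R : realType) (x : R) (m : nat) :
  is_derive x 1 (fun t : R => t ^+ m.+1) (m.+1%:R * x ^+ m).
Proof.
have := @is_deriveX _ _ (id : R -> R) m.+1 x 1 1 (is_derive_id _ _).
apply: is_derive_ext; first by apply/funext => t; rewrite exprfctE.
exact: mulr1.
Qed.

Lemma cvg_lin (R : realType) (F : set_system R) (FF : Filter F)
    (f g : R -> R) (a b j k : R) :
  f x @[x --> F] --> a -> g x @[x --> F] --> b ->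
  (j * f x + k * g x) @[x --> F] --> j * a + k * b.
Proof.
by move=> fa gb; apply: cvgD; apply: cvgM => //; exact: cvg_cst.
Qed.

Lemma primitive_ge (R : realType) (b l : R) (U u : R -> R) :
  (forall x : R, 0 < x < b -> is_derive x 1 U (u x)) ->
  (forall x : R, 0 < x < b -> 0 <= u x) ->
  U x @[x --> 0^'+] --> l -> forall x : R, 0 < x < b -> l <= U x.
Proof.
by move=> dU u0; apply: nondecreasing_ge_lim; exact: nondecreasing_oo dU u0.
Qed.

(** The comparison principle behind all later estimates: [U], [u], [q] will be differences of
    heights, of slopes and of curvatures of two functions. *)
Lemma concave_primitive_ge0 (R : realType) (b l r : R) (U u q : R -> R) :
  (forall x : R, 0 < x < b -> is_derive x 1 U (u x)) ->
  (forall x : R, 0 < x < b -> is_derive x 1 u (q x)) ->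
  (forall x y : R, 0 < x -> x <= y -> y < b -> q y <= q x) ->
  U x @[x --> 0^'+] --> 0 ->
  u x @[x --> 0^'+] --> l -> 0 <= l -> u x @[x --> b^'-] --> r -> 0 <= r ->
  forall x : R, 0 < x < b -> 0 <= U x.
Proof.
move=> dU du qn U0 ul l0 ur r0; apply: primitive_ge dU _ U0.
exact: concave_ge0 du qn ul l0 ur r0.
Qed.

(** * Solutions as triples (height, slope, curvature): monotonicity and quadratic growth *)

Definition profile (R : realType) (n : R) (H v q : R -> R) : Prop :=
  forall x : R, 0 < x < 1 -> [/\ 0 < H x, is_derive x 1 H (v x),
    is_derive x 1 v (q x) & is_derive x 1 q (H x `^ (1 - n) * (x - 1))].

Definition flat_ends (R : realType) (H v : R -> R) : Prop :=
  [/\ H x @[x --> 0^'+] --> 0, v x @[x --> 0^'+] --> 0 & v x @[x --> 1^'-] --> 0].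

Lemma profile_curvature_lt (R : realType) (n : R) (H v q : R -> R) :
  profile n H v q -> forall x y : R, 0 < x -> x < y -> y < 1 -> q y < q x.
Proof.
move=> pr x y x0 xy y1.
have dq (z : R) : 0 < z < 1 -> is_derive z 1 q (H z `^ (1 - n) * (z - 1)) by case/pr.
have [c cxy e] := mvt_oo dq x0 xy y1.
have [|Hc _ _ _] := pr c; first by lra.
rewrite -subr_lt0 e pmulr_llt0 ?subr_gt0// pmulr_rlt0 ?powR_gt0//; lra.
Qed.

Lemma profile_curvature_le (R : realType) (n : R) (H v q : R -> R) :
  profile n H v q -> forall x y : R, 0 < x -> x <= y -> y < 1 -> q y <= q x.
Proof.
move=> pr x y x0; rewrite le_eqVlt => /predU1P[-> //|xy] y1.
exact/ltW/(profile_curvature_lt pr).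
Qed.

(** Concavity gives v >= 0. An interior zero would be a minimum, so by the mean value theorem the
    curvature would be <= 0 somewhere to its left and >= 0 somewhere to its right, although it
    strictly decreases. *)
Lemma profile_slope_gt0 (R : realType) (n : R) (H v q : R -> R) :
  profile n H v q -> flat_ends H v -> forall x : R, 0 < x < 1 -> 0 < v x.
Proof.
move=> pr [_ v0 v1] x x01.
have dv (z : R) : 0 < z < 1 -> is_derive z 1 v (q z) by case/pr.
have vge0 := concave_ge0 dv (profile_curvature_le pr) v0 (lexx 0) v1 (lexx 0).
rewrite lt_neqAle vge0// andbT; apply/eqP => vx.
have [|||c cb ec] := @mvt_oo R 0 1 v q dv (x / 2) x; [lra..|].
have [|||d db ed] := @mvt_oo R 0 1 v q dv x ((x + 1) / 2); [lra..|].
have vl : 0 <= v (x / 2) by apply: vge0; lra.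
have vr : 0 <= v ((x + 1) / 2) by apply: vge0; lra.
have : q d < q c by apply: (profile_curvature_lt pr); lra.
have : q c <= 0 by nra.
have : 0 <= q d by nra.
lra.
Qed.

Lemma profile_ge_square (R : realType) (n : R) (H v q : R -> R) :
  profile n H v q -> flat_ends H v ->
  exists2 c, 0 < c & forall x : R, 0 < x < 1 -> c * x ^+ 2 <= H x.
Proof.
move=> pr fe; have [H0 v0 v1] := fe.
have dH (z : R) : 0 < z < 1 -> is_derive z 1 H (v z) by case/pr.
have dv (z : R) : 0 < z < 1 -> is_derive z 1 v (q z) by case/pr.
have vgt0 := profile_slope_gt0 pr fe.
have Hmono := nondecreasing_oo dH (fun x h => ltW (vgt0 x h)).
pose k := v (1 / 2).
have k0 : 0 < k by apply: vgt0; lra.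
(* On ]0, 1/2[ the concave slope lies above its chord 2 k x; integrating from 0 gives H >= k x^2. *)
have Hk : forall x : R, 0 < x < 1 / 2 -> 0 <= 1 * H x + - k * x ^+ 2.
  pose u (x : R) := 1 * v x + (- (2 * k)) * x.
  pose w (x : R) := 1 * q x + (- (2 * k)) * 1.
  apply: (@concave_primitive_ge0 _ _ 0 0 _ u w) => //.
  - move=> z z01; have dHz : is_derive z 1 H (v z) by apply: dH; lra.
    apply: is_derive_ext (is_derive_lin 1 (- k) dHz (is_derive_monomial z 1)) => //.
    by rewrite /u; ring.
  - move=> z z01; have dvz : is_derive z 1 v (q z) by apply: dv; lra.
    exact: (is_derive_lin _ _ dvz (is_derive_id _ _)).
  - move=> y z y0 yz z1; rewrite /w.
    by have := profile_curvature_le pr y0 yz; lra.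
  - rewrite -[X in _ --> X](_ : 1 * 0 + - k * 0 ^+ 2 = 0); last by ring.
    apply: cvg_lin => //; apply: cvg_at_right_filter.
    exact: exprn_continuous.
  - rewrite -[X in _ --> X](_ : 1 * 0 + - (2 * k) * 0 = 0); last by ring.
    by apply: cvg_lin => //; apply: cvg_at_right_filter; exact: cvg_id.
  - rewrite -[X in _ --> X](_ : 1 * k + - (2 * k) * (1 / 2) = 0); last by field.
    apply: cvg_lin => //; apply: cvg_at_left_filter; last exact: cvg_id.
    by apply: (@is_derive_cvg _ _ _ (q (1 / 2))); apply: dv; lra.
(* Beyond 1/2 monotonicity gives H x >= H (1/4) >= k / 16. *)
exists (k / 16) => [|x x01]; first by lra.
have [xl|xg] := ltP x (1 / 2); first by have := Hk x; nra.
have h1 : 0 <= 1 * H (1 / 4) + - k * (1 / 4) ^+ 2 by apply: Hk; lra.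
have h2 : H (1 / 4) <= H x by apply: Hmono; lra.
have h3 : x ^+ 2 <= 1 by nra.
have : k / 16 * x ^+ 2 <= k / 16 by rewrite ler_piMr//; lra.
by lra.
Qed.

(** * Uniqueness *)

Lemma le0_ler_powR (R : realType) (s a b : R) :
  s <= 0 -> 0 < a -> a <= b -> b `^ s <= a `^ s.
Proof.
move=> s0 a0 ab; have b0 : 0 < b by exact: lt_le_trans ab.
rewrite -[s]opprK !(powRN _ (- s)) lef_pV2 ?posrE ?powR_gt0//.
by apply: ge0_ler_powR; rewrite ?oppr_ge0// nnegrE ltW.
Qed.

(** For n <= 1 the power is bounded. For n > 1 the bound H >= c x^2 leaves the singularity
    x^(-2(n-1)), which is integrable precisely because n < 3/2. *)
Lemma profile_rhs_le (R : realType) (n c B : R) (H v q : R -> R) :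
  n < 3 / 2 -> 0 < c ->
  (forall x : R, 0 < x < 1 -> c * x ^+ 2 <= H x) ->
  (forall x : R, 0 < x < 1 -> H x <= B) ->
  exists K tau : R, [/\ 0 <= K, tau < 1 &
    forall x : R, 0 < x < 1 -> H x `^ (1 - n) <= K * x `^ (- tau)].
Proof.
move=> n32 c0 Hc HB.
have [n1|n1] := leP n 1.
  exists (B `^ (1 - n)), 0; split; [exact: powR_ge0|lra|] => x x01.
  rewrite oppr0 powRr0 mulr1; apply: ge0_ler_powR; rewrite ?nnegrE ?HB//; first lra.
  + by apply: le_trans (Hc x x01); rewrite mulr_ge0 ?sqr_ge0// ltW.
  + by apply: le_trans (HB x x01); apply: le_trans (Hc x x01); rewrite mulr_ge0 ?sqr_ge0// ltW.
exists (c `^ (1 - n)), (2 * (n - 1)); split; [exact: powR_ge0|lra|] => x x01.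
have x0 : 0 < x by lra.
have cx : 0 < c * x ^+ 2 by rewrite mulr_gt0// exprn_gt0.
have -> : - (2 * (n - 1)) = 2 * (1 - n) by ring.
rewrite powRrM -[in _ `^ 2]/(2%:R) powR_mulrn ?(ltW x0)//.
rewrite -powRM ?(ltW c0) ?sqr_ge0//; apply: le0_ler_powR; [lra|by []|exact: Hc].
Qed.

(** The integrable bound on q' makes q + k x^(1 - tau) nondecreasing, so q is bounded above near 0,
    and two integrations from 0 give a multiple of x^2. From 1/2 on, H <= B <= 4 B x^2. *)
Lemma profile_le_square (R : realType) (n B : R) (H v q : R -> R) :
  n < 3 / 2 -> profile n H v q -> flat_ends H v ->
  (forall x : R, 0 < x < 1 -> H x <= B) ->
  exists2 C, 0 < C & forall x : R, 0 < x < 1 -> H x <= C * x ^+ 2.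
Proof.
move=> n32 pr fe HB; have [H0 v0 v1] := fe.
have dH (z : R) : 0 < z < 1 -> is_derive z 1 H (v z) by case/pr.
have dv (z : R) : 0 < z < 1 -> is_derive z 1 v (q z) by case/pr.
have dq (z : R) : 0 < z < 1 -> is_derive z 1 q (H z `^ (1 - n) * (z - 1)) by case/pr.
have [c c0 Hc] := profile_ge_square pr fe.
have [K [tau [K0 tau1 HK]]] := profile_rhs_le v q n32 c0 Hc HB.
pose k := K / (1 - tau).
have k0 : 0 <= k by rewrite divr_ge0//; lra.
have kmono : forall x y : R, 0 < x -> x <= y -> y < 1 ->
    1 * q x + k * x `^ (1 - tau) <= 1 * q y + k * y `^ (1 - tau).
  apply: (@nondecreasing_oo _ _ _ _ (fun x => 1 * (H x `^ (1 - n) * (x - 1)) +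
     k * ((1 - tau) * x `^ (1 - tau - 1)))) => x x01.
    apply: is_derive_lin; first exact: dq.
    by apply: is_derive1_powR; lra.
  have -> : 1 - tau - 1 = - tau by ring.
  have -> : k * ((1 - tau) * x `^ (- tau)) = K * x `^ (- tau).
    by rewrite /k; field; lra.
  have := HK x x01; have := powR_ge0 (H x) (1 - n); nra.
pose D := q (1 / 2) + k * (1 / 2) `^ (1 - tau).
have qD (x : R) : 0 < x < 1 / 2 -> q x <= D.
  move=> x01; have h : 1 * q x + k * x `^ (1 - tau) <= 1 * q (1 / 2) + k * (1 / 2) `^ (1 - tau).
    by apply: kmono; lra.
  have : 0 <= k * x `^ (1 - tau) by rewrite mulr_ge0 ?powR_ge0.
  by rewrite /D; lra.
have vD : forall x : R, 0 < x < 1 / 2 -> 0 <= (- 1) * v x + D * x.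
  apply: (@primitive_ge _ _ _ _ (fun x => (-1) * q x + D * 1)).
  - move=> x x01; have dvx : is_derive x 1 v (q x) by apply: dv; lra.
    exact: (is_derive_lin _ _ dvx (is_derive_id _ _)).
  - by move=> x /qD; lra.
  - rewrite -[X in _ --> X](_ : (-1) * 0 + D * 0 = 0); last by ring.
    by apply: cvg_lin => //; apply: cvg_at_right_filter; exact: cvg_id.
have HD : forall x : R, 0 < x < 1 / 2 -> 0 <= (- 1) * H x + (D / 2) * x ^+ 2.
  apply: (@primitive_ge _ _ _ _ (fun x => (-1) * v x + D / 2 * (2%:R * x ^+ 1))).
  - move=> x x01; have dHx : is_derive x 1 H (v x) by apply: dH; lra.
    exact: (is_derive_lin _ _ dHx (is_derive_monomial _ _)).
  - by move=> x /vD; lra.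
  - rewrite -[X in _ --> X](_ : (-1) * 0 + (D / 2) * 0 ^+ 2 = 0); last by ring.
    apply: cvg_lin => //; apply: cvg_at_right_filter.
    exact: exprn_continuous.
have B0 : 0 < B.
  have [|h _ _ _] := pr (1 / 2); first by lra.
  by apply: lt_le_trans h (HB _ _); lra.
exists (4 * B + `|D|) => [|x x01]; first by have := normr_ge0 D; lra.
have x2 : 0 <= x ^+ 2 by exact: sqr_ge0.
have Dn : 0 <= `|D| * x ^+ 2 by rewrite mulr_ge0.
have Bn : 0 <= B * x ^+ 2 by rewrite mulr_ge0 // ltW.
have [xl|xg] := ltP x (1 / 2).
  have h : 0 <= (- 1) * H x + (D / 2) * x ^+ 2 by apply: HD; lra.
  have : D * x ^+ 2 <= `|D| * x ^+ 2 by rewrite ler_wpM2r// ler_norm.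
  by lra.
have h := HB x x01.
have : B * (1 / 4) <= B * x ^+ 2 by rewrite ler_pM2l//; nra.
by lra.
Qed.

(** Depending on the sign of [s], one or the other of the two symmetric bounds is raised to the
    power [s]. *)
Lemma powR_ratio (R : realType) (s M a b : R) : 1 <= M -> 0 < a -> 0 < b ->
  a <= M * b -> b <= M * a -> a `^ s <= M `^ `|s| * b `^ s.
Proof.
move=> M1 a0 b0 ab ba; have M0 : 0 < M by lra.
have [s0|s0] := leP 0 s.
  rewrite ger0_norm// -powRM ?(ltW M0) ?(ltW b0)//.
  by apply: ge0_ler_powR => //; rewrite nnegrE ltW// mulr_gt0.
rewrite ltr0_norm// powRN mulrC ler_pdivlMr ?powR_gt0// -powRM ?(ltW M0) ?(ltW a0)//.
by apply: le0_ler_powR; [exact: ltW|exact: b0|rewrite mulrC].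
Qed.

(** With L = M^|1 - n|, the third derivative of L H2 - H1 is (L H2^(1-n) - H1^(1-n)) (x - 1) <= 0 by
    [powR_ratio], and all its boundary limits vanish, so the comparison principle applies. *)
Lemma profile_ratio_contract (R : realType) (n M : R) (H1 v1 q1 H2 v2 q2 : R -> R) :
  profile n H1 v1 q1 -> flat_ends H1 v1 ->
  profile n H2 v2 q2 -> flat_ends H2 v2 -> 1 <= M ->
  (forall x : R, 0 < x < 1 -> H1 x <= M * H2 x) ->
  (forall x : R, 0 < x < 1 -> H2 x <= M * H1 x) ->
  forall x : R, 0 < x < 1 -> H1 x <= M `^ `|1 - n| * H2 x.
Proof.
move=> p1 [H10 v10 v11] p2 [H20 v20 v21] M1 H12 H21.
set L := M `^ `|1 - n|.
suff : forall x : R, 0 < x < 1 -> 0 <= L * H2 x + (-1) * H1 x.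
  by move=> h x /h; lra.
pose u (x : R) := L * v2 x + (-1) * v1 x.
pose w (x : R) := L * q2 x + (-1) * q1 x.
apply: (@concave_primitive_ge0 _ _ 0 0 _ u w) => //.
- by move=> z z01; apply: is_derive_lin; [case: (p2 z z01)|case: (p1 z z01)].
- by move=> z z01; apply: is_derive_lin; [case: (p2 z z01)|case: (p1 z z01)].
- apply: (@nonincreasing_oo _ _ _ _ (fun z => L * (H2 z `^ (1 - n) * (z - 1)) +
    (-1) * (H1 z `^ (1 - n) * (z - 1)))) => z z01.
    by apply: is_derive_lin; [case: (p2 z z01)|case: (p1 z z01)].
  have [h1 _ _ _] := p1 z z01; have [h2 _ _ _] := p2 z z01.
  have h := @powR_ratio _ (1 - n) M (H1 z) (H2 z) M1 h1 h2 (H12 z z01) (H21 z z01).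
  rewrite -/L in h.
  have -> : L * (H2 z `^ (1 - n) * (z - 1)) + (-1) * (H1 z `^ (1 - n) * (z - 1)) =
    (L * H2 z `^ (1 - n) - H1 z `^ (1 - n)) * (z - 1) by ring.
  by rewrite mulr_ge0_le0//; lra.
- rewrite -[X in _ --> X](_ : L * 0 + (-1) * 0 = 0); last by ring.
  exact: cvg_lin.
- rewrite -[X in _ --> X](_ : L * 0 + (-1) * 0 = 0); last by ring.
  exact: cvg_lin.
- rewrite -[X in _ --> X](_ : L * 0 + (-1) * 0 = 0); last by ring.
  exact: cvg_lin.
Qed.

(* The exponent |1 - n| < 1 makes the map H |-> (solution with right-hand side
   H^(1-n)) a contraction for Thompson's metric. *)
Lemma profile_unique (R : realType) (n B : R) (H1 v1 q1 H2 v2 q2 : R -> R) :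
  0 < n < 3 / 2 ->
  profile n H1 v1 q1 -> flat_ends H1 v1 -> (forall x : R, 0 < x < 1 -> H1 x <= B) ->
  profile n H2 v2 q2 -> flat_ends H2 v2 -> (forall x : R, 0 < x < 1 -> H2 x <= B) ->
  forall x : R, 0 < x < 1 -> H1 x = H2 x.
Proof.
move=> /andP[n0 n32] p1 f1 B1 p2 f2 B2.
have [c1 c10 Hc1] := profile_ge_square p1 f1.
have [c2 c20 Hc2] := profile_ge_square p2 f2.
have [C1 C10 HC1] := profile_le_square n32 p1 f1 B1.
have [C2 C20 HC2] := profile_le_square n32 p2 f2 B2.
pose S : set R := [set M | [/\ 1 <= M,
  forall x : R, 0 < x < 1 -> H1 x <= M * H2 x &
  forall x : R, 0 < x < 1 -> H2 x <= M * H1 x]].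
have S0 : S !=set0.
  (* Both heights lie between multiples of x^2, so each ratio is bounded by C1 / c2 or C2 / c1; the
     summand 1 ensures M >= 1. *)
  exists (1 + C1 / c2 + C2 / c1).
  have h1 : 0 < C1 / c2 by exact: divr_gt0.
  have h2 : 0 < C2 / c1 by exact: divr_gt0.
  split=> [|x x01|x x01]; first by lra.
  - apply: le_trans (HC1 x x01) _.
    have -> : C1 * x ^+ 2 = C1 / c2 * (c2 * x ^+ 2) by field; lra.
    by apply: ler_pM; rewrite ?Hc2 ?mulr_ge0 ?sqr_ge0 ?invr_ge0 ?ltW//; lra.
  - apply: le_trans (HC2 x x01) _.
    have -> : C2 * x ^+ 2 = C2 / c1 * (c1 * x ^+ 2) by field; lra.
    by apply: ler_pM; rewrite ?Hc1 ?mulr_ge0 ?sqr_ge0 ?invr_ge0 ?ltW//; lra.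
have Slb : lbound S 1 by move=> M [].
have Sinf : has_inf S by split => //; exists 1.
set M := inf S.
have M1 : 1 <= M by exact: lb_le_inf.
(* The infimum is attained: every constraint reads as a lower bound on M by a ratio of heights at
   one point. *)
have SM : S M.
  split => // x x01.
  - have [h2 _ _ _] := p2 x x01.
    by rewrite -ler_pdivrMr//; apply: lb_le_inf => // N [_ h _]; rewrite ler_pdivrMr// h.
  - have [h1 _ _ _] := p1 x x01.
    by rewrite -ler_pdivrMr//; apply: lb_le_inf => // N [_ _ h]; rewrite ler_pdivrMr// h.
have b1 : `|1 - n| < 1 by rewrite ltr_norml; lra.
have SL : S (M `^ `|1 - n|).
  have [_ S1 S2] := SM; split.
  - by rewrite -(powRr0 M) ler_powR.
  - exact: profile_ratio_contract p1 f1 p2 f2 M1 S1 S2.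
  - exact: profile_ratio_contract p2 f2 p1 f1 M1 S2 S1.
have ML : M <= M `^ `|1 - n| by apply: ge_inf => //; exists 1.
have Me : M = 1.
  apply/eqP; rewrite eq_le M1 andbT leNgt; apply/negP => M1'.
  have : M `^ `|1 - n| < M `^ 1.
    by rewrite /powR gt_eqF ?ltr_expR ?ltr_pM2r ?ln_gt0//; lra.
  by rewrite powRr1; lra.
move=> x x01; have [_ S1 S2] := SM; apply/eqP; rewrite eq_le.
by have := S1 x x01; have := S2 x x01; rewrite Me !mul1r => -> ->.
Qed.

(** * The discrete problem *)

(** By concavity of the power, its increment dominates the slope at the right end. The case y = 0 is
    separate, since the derivative formula is available only at positive points; there the claim is
    s x^s <= x^s. *)
Lemma powR_tangent (R : realType) (s x y : R) : 0 < s <= 1 -> 0 <= y -> y < x ->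
  s * x `^ (s - 1) * (x - y) <= x `^ s - y `^ s.
Proof.
move=> /andP[s0 s1]; rewrite le_eqVlt => /predU1P[<-{y} x0|y0 yx].
  rewrite powR0 ?gt_eqF// !subr0 -mulrA (mulrC _ x) mulr_powRB1 ?(ltW x0)//.
  by rewrite ler_piMl ?powR_ge0.
have dp (z : R) : 0 < z < x + 1 -> is_derive z 1 (@powR R ^~ s) (s * z `^ (s - 1)).
  by move=> z01; apply: is_derive1_powR; lra.
have [|c cyx ->] := mvt_oo dp y0 yx; first lra.
rewrite ler_pM2r ?subr_gt0// ler_pM2l//.
by apply: le0_ler_powR; lra.
Qed.

(** * Uniform meshes and Riemann sums *)

Definition mesh (R : realType) (N : nat) : R := N.+1%:R^-1.
(** The shift by one makes the nodes right endpoints of the cells: 0, where the right-hand side may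
    be singular, is avoided, and the node of index N is 1. *)
Definition node (R : realType) (N j : nat) : R := j.+1%:R * mesh R N.

Lemma mesh_gt0 (R : realType) (N : nat) : 0 < mesh R N.
Proof. by rewrite invr_gt0 ltr0Sn. Qed.

Lemma node_gt0 (R : realType) (N j : nat) : 0 < node R N j.
Proof. by rewrite mulr_gt0 ?ltr0Sn ?mesh_gt0. Qed.

Lemma node_le1 (R : realType) (N j : nat) : (j < N.+1)%N -> node R N j <= 1.
Proof. by move=> jN; rewrite /node /mesh ler_pdivrMr ?ltr0Sn// mul1r ler_nat. Qed.

Lemma ler_node (R : realType) (N i j : nat) : (node R N i <= node R N j) = (i <= j)%N.
Proof. by rewrite ler_pM2r ?mesh_gt0// ler_nat ltnS. Qed.

(** The right side is the integral of x^(-tau) over ]0, 1[. By [powR_tangent], each term times 1 -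
    tau is at most an increment of x^(1 - tau), and the increments telescope. *)
Lemma riemann_sum_powR (R : realType) (N : nat) (tau : R) : 0 <= tau < 1 ->
  mesh R N * \sum_(j < N.+1) node R N j `^ (- tau) <= (1 - tau)^-1.
Proof.
move=> /andP[t0 t1]; set h := mesh R N.
have h0 : 0 < h by exact: mesh_gt0.
pose s := 1 - tau.
have key m : s * (h * \sum_(j < m) node R N j `^ (- tau)) <= (m%:R * h) `^ s.
  elim: m => [|m IH]; first by rewrite big_ord0 !mulr0 powR_ge0.
  rewrite big_ord_recr/= mulrDr mulrDr.
  have := @powR_tangent R s (m.+1%:R * h) (m%:R * h).
  have -> : s - 1 = - tau by rewrite /s; ring.
  have -> : m.+1%:R * h - m%:R * h = h by rewrite -natr1; ring.
  rewrite -/(node R N m) => /(_ _ _ _)/le_trans H.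
  have {}H : s * node R N m `^ (- tau) * h <= node R N m `^ s - (m%:R * h) `^ s.
    apply: H => //; first by rewrite /s; lra.
      by rewrite mulr_ge0// ltW.
    by rewrite ltr_pM2r// ltr_nat.
  move: H; rewrite /node -/h; lra.
rewrite -[leRHS]mul1r ler_pdivlMr ?subr_gt0// mulrC.
apply: le_trans (key N.+1) _.
by rewrite /h /mesh divff ?pnatr_eq0// powR1.
Qed.

Lemma mesh_count (R : realType) (N : nat) (x : R) : 0 <= x <= 1 ->
  x - mesh R N <= mesh R N * \sum_(j < N.+1) (node R N j <= x)%R%:R <= x.
Proof.
move=> /andP[x0 x1]; set h := mesh R N.
have h0 : 0 < h by exact: mesh_gt0.
(* The induction counts only the first m nodes, so both bounds are truncated at m h; for m = N + 1
   this is 1 and the truncation disappears. *)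
have key m : Num.min (x - h) (m%:R * h) <= h * \sum_(j < m) (node R N j <= x)%R%:R
    <= Num.min x (m%:R * h).
  elim: m => [|m IH].
    by rewrite big_ord0 mulr0 mul0r ge_min lexx orbT le_min x0 lexx.
  rewrite big_ord_recr/= mulrDr.
  have e : m.+1%:R * h = m%:R * h + h by rewrite -natr1; ring.
  move: IH; rewrite /node -/h e.
  set S := h * _; set k := m%:R * h.
  rewrite !ge_min !le_min => /andP[/orP A /andP[B1 B2]].
  case: (leP (k + h) x) => kx; rewrite /= ?mulr1n ?mulr0n ?mulr1 ?mulr0 ?addr0.
    apply/andP; split; first by apply/orP; right; case: A => A; lra.
    by apply/andP; split; lra.
  apply/andP; split; first by apply/orP; left; case: A => A; lra.
  by apply/andP; split; lra.
have := key N.+1.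
rewrite /h /mesh divff ?pnatr_eq0// -/(mesh R N) -/h.
by rewrite ge_min le_min => /andP[/orP[A|A] /andP[B1 B2]]; apply/andP; split; lra.
Qed.

(** Each unknown depends only on earlier ones, so it is obtained by recursion. Continuity in the
    parameter [c] is carried along because [c] will be chosen by the intermediate value theorem. *)
Lemma triangular_system (R : realType) (m : nat) (f b : nat -> R -> R)
    (a : nat -> nat -> R) :
  (forall j, (j < m)%N -> continuous (f j)) -> (forall j, continuous (b j)) ->
  exists p : nat -> R -> R, forall j, (j < m)%N -> continuous (p j) /\
    forall c, p j c = f j (b j c + \sum_(i < j) a j i * p i c).
Proof.
move=> + cb; elim: m => [_|m IH cf]; first by exists (fun _ _ => 0).
have [|p hp] := IH; first by move=> j jm; apply: cf; exact: ltnW.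
exists (fun j => if (j < m)%N then p j else
  fun c => f j (b j c + \sum_(i < j) a j i * p i c)) => j.
rewrite ltnS leq_eqVlt => /predU1P[->|jm].
  rewrite ltnn; split=> c; last first.
    by congr (f m (_ + _)); apply: eq_bigr => i _; rewrite ltn_ord.
  apply: (@continuous_comp _ _ _ (fun c => b m c + \sum_(i < m) a m i * p i c)); last exact: cf.
  apply: cvgD; first exact: cb.
  apply: cvg_big => [|i _]; first exact: add_continuous.
  apply: cvgM; first exact: cvg_cst.
  exact: (hp i (ltn_ord i)).1.
rewrite jm; have [cp e] := hp j jm; split=> // c; rewrite e.
congr (f j (_ + _)); apply: eq_bigr => i _.
by rewrite (ltn_trans (ltn_ord i) jm).
Qed.

(** * Green's function of the linear problem and its Taylor remainders *)

Definition pospart (R : realType) (a : R) : R := Num.max 0 a.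

(* Green's function of -v'' with v(0) = v(1) = 0, its primitive vanishing at 0,
   and its derivative. *)
Definition green (R : realType) (x s : R) : R := x * (1 - s) - pospart (x - s).
Definition green_prim (R : realType) (x s : R) : R :=
  x ^+ 2 / 2 * (1 - s) - pospart (x - s) ^+ 2 / 2.
Definition green_deriv (R : realType) (x s : R) : R := 1 - s - (s <= x)%R%:R.

Lemma pospartP (R : realType) (x s : R) :
  (s <= x /\ pospart (x - s) = x - s) \/ (x < s /\ pospart (x - s) = 0).
Proof.
rewrite /pospart; have [sx|xs] := leP s x.
  by left; split=> //; rewrite max_r// subr_ge0.
by right; split=> //; rewrite max_l// subr_le0 ltW.
Qed.

Lemma green_itv (R : realType) (x s : R) : 0 <= x <= 1 -> 0 < s <= 1 ->
  0 <= green x s <= Num.min x s.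
Proof.
rewrite /green le_min => /andP[x0 x1] /andP[s0 s1].
have xs : 0 <= x * s by rewrite mulr_ge0// ltW.
have x1s : 0 <= x * (1 - s) by rewrite mulr_ge0//; lra.
have s1x : 0 <= s * (1 - x) by rewrite mulr_ge0//; lra.
by have [[h ->]|[h ->]] := pospartP x s; apply/and3P; split; lra.
Qed.

Lemma green_prim_itv (R : realType) (x s : R) : 0 <= x <= 1 -> 0 < s <= 1 ->
  0 <= green_prim x s <= x * Num.min x s.
Proof.
rewrite /green_prim => /andP[x0 x1] /andP[s0 s1].
have xs : 0 <= x ^+ 2 * s by rewrite mulr_ge0 ?sqr_ge0// ltW.
have x1s : 0 <= x ^+ 2 * (1 - s) by rewrite mulr_ge0 ?sqr_ge0//; lra.
have sx0 : 0 <= s * x by rewrite mulr_ge0// ltW.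
have [[h ->]|[h ->]] := pospartP x s; apply/andP; split.
- have -> : x ^+ 2 / 2 * (1 - s) - (x - s) ^+ 2 / 2 =
    s / 2 * (x * (1 - x) + (x - s)) by field.
  by rewrite mulr_ge0//; [lra|nra].
- rewrite min_r//.
  have -> : x ^+ 2 / 2 * (1 - s) - (x - s) ^+ 2 / 2 =
    x * s - s / 2 * (x ^+ 2 + s) by field.
  by rewrite gerBl mulr_ge0//; [lra|have := sqr_ge0 x; lra].
- by lra.
- by rewrite min_l ?(ltW h)//; lra.
Qed.

(** If s <= x, the left side is s and d <= 1; otherwise s > d and the left side is at most 1. The
    factor s on the right compensates the singularity of the data at 0. *)
Lemma green_deriv_le (R : realType) (d x s : R) : 0 < d <= x -> x <= 1 -> 0 < s <= 1 ->
  `|green_deriv x s| <= s / d.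
Proof.
move=> /andP[d0 dx] x1 /andP[s0 s1]; rewrite ler_pdivlMr// /green_deriv.
have [sx|xs] := leP s x; rewrite /= ?mulr1n ?mulr0n ?subr0.
  rewrite ler0_norm; last by lra.
  have : s * d <= s * 1 by rewrite ler_pM2l//; lra.
  by lra.
rewrite ger0_norm; last by lra.
have : (1 - s) * d <= 1 * d by rewrite ler_pM2r//; lra.
by lra.
Qed.

(** Green's function is affine in its first argument on either side of s, so the remainder vanishes
    unless s separates x and y. *)
Lemma green_taylor (R : realType) (x y s : R) :
  `|green y s - green x s - green_deriv x s * (y - x)| <=
  `|(s <= y)%R%:R - (s <= x)%R%:R| * `|y - x|.
Proof.
rewrite /green /green_deriv.
have [[h ->]|[h ->]] := pospartP x s; have [[k ->]|[k ->]] := pospartP y s;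
  rewrite ?h ?k ?(lt_geF h) ?(lt_geF k) /= ?mulr1n ?mulr0n ?subr0 ?sub0r ?normrN
    ?normr1 ?subrr ?normr0 ?mul0r ?mul1r.
- by rewrite (_ : _ - _ = 0) ?normr0//; ring.
- rewrite (_ : _ - _ = y - s); last by ring.
  by rewrite !ler0_norm; lra.
- rewrite (_ : _ - _ = s - y); last by ring.
  by rewrite ler0_norm ?ger0_norm; lra.
- by rewrite (_ : _ - _ = 0) ?normr0//; ring.
Qed.

(** If s lies below both points, the remainder is exactly -s (y - x)^2 / 2. In the other cases s >=
    d, so s / d >= 1 and a bound by (y - x)^2 suffices. *)
Lemma green_prim_taylor (R : realType) (d x y s : R) :
  0 < d -> d <= x <= 1 -> d <= y -> 0 < s <= 1 ->
  `|green_prim y s - green_prim x s - green x s * (y - x)| <= s / d * (y - x) ^+ 2.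
Proof.
move=> d0 /andP[dx x1] dy /andP[s0 s1]; rewrite /green_prim /green.
have e0 : 0 <= (y - x) ^+ 2 by exact: sqr_ge0.
have se0 : 0 <= s * (y - x) ^+ 2 by rewrite mulr_ge0// ltW.
have sd1 : s * (y - x) ^+ 2 <= s / d * (y - x) ^+ 2.
  by rewrite ler_wpM2r// ler_pdivlMr// ler_piMr//; lra.
have sd2 : d <= s -> (y - x) ^+ 2 <= s / d * (y - x) ^+ 2.
  by move=> ds; rewrite ler_peMl// ler_pdivlMr// mul1r.
have [[h ->]|[h ->]] := pospartP x s; have [[k ->]|[k ->]] := pospartP y s.
- rewrite (_ : _ - _ = - (s * (y - x) ^+ 2 / 2)); last by field.
  by rewrite ler0_norm; lra.
- apply: le_trans (sd2 _); last by lra.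
  rewrite (_ : _ - _ = (y - s) ^+ 2 / 2 - s * (y - x) ^+ 2 / 2); last by field.
  by rewrite ler_norml; apply/andP; split; nra.
- apply: le_trans (sd2 _); last by lra.
  rewrite (_ : _ - _ = (1 - s) * (y - x) ^+ 2 / 2 - (y - s) ^+ 2 / 2); last by field.
  by rewrite ler_norml; apply/andP; split; nra.
- apply: le_trans (sd2 _); last by lra.
  rewrite (_ : _ - _ = (1 - s) * (y - x) ^+ 2 / 2); last by field.
  by rewrite ler_norml; apply/andP; split; nra.
Qed.

(** The integral of [k] against point masses [mesh R N * p j] at the nodes. *)
Definition quad (R : realType) (N : nat) (p : nat -> R) (k : R -> R) : R :=
  mesh R N * \sum_(j < N.+1) p j * k (node R N j).

(** A shooting argument. With c = H''(0) prescribed, the height at a node involves only the masses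
    at earlier nodes; c is then adjusted to make the slope vanish at 1, which turns the initial
    value formula into the one with Green's function. *)
Lemma discrete_profile (R : realType) (N : nat) (theta : R) (F : R -> R -> R) (P : R -> R) :
  (forall j, (j < N.+1)%N -> continuous (F (node R N j))) ->
  (forall j h, (j < N.+1)%N -> 0 <= F (node R N j) h <= P (node R N j)) ->
  exists p : nat -> R, forall j, (j < N.+1)%N ->
    p j = F (node R N j) (theta * (node R N j - node R N j ^+ 2 / 2) +
                          quad N p (green_prim (node R N j))).
Proof.
move=> cF FP; set h := mesh R N; set s := node R N.
have h0 : 0 < h by exact: mesh_gt0.
have [|p hp] := @triangular_system R N.+1 (fun j => F (s j))
  (fun j c => theta * s j + c * (s j ^+ 2 / 2))
  (fun j i => - h * ((s j - s i) ^+ 2 / 2)) cF.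
  by move=> j c; apply: cvgD; [exact: cvg_cst|apply: cvgM; [exact: cvg_id|exact: cvg_cst]].
(* [g c] is the slope at 1 of the discrete solution with curvature c at 0. *)
pose g c := c + theta - quad N (p^~ c) (fun t => 1 - t).
have gc : continuous g.
  move=> c; apply: cvgB; first by apply: cvgD; [exact: cvg_id|exact: cvg_cst].
  apply: cvgM; first exact: cvg_cst.
  apply: cvg_big => [|i _]; first exact: add_continuous.
  by apply: cvgM; [exact: (hp i (ltn_ord i)).1|exact: cvg_cst].
have p0 j c : (j < N.+1)%N -> 0 <= p j c <= P (s j).
  by move=> jN; rewrite (hp j jN).2; exact: FP.
have s01 j : (j < N.+1)%N -> 0 <= 1 - s j <= 1.
  by move=> jN; rewrite subr_ge0 node_le1//= gerBl ltW ?node_gt0.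
(* The integral subtracted in [g] lies in [0, B] whatever c is, so [g] changes sign on
   [-theta, B - theta]. *)
pose B := h * \sum_(j < N.+1) P (s j).
have B0 : 0 <= B.
  rewrite mulr_ge0 ?(ltW h0)// sumr_ge0// => j _.
  by have /andP[] := p0 j 0 (ltn_ord j); exact: le_trans.
have [|||c _ gc0] := @IVT R g (- theta) (B - theta) 0.
- by lra.
- exact: continuous_subspaceT.
- rewrite ge_min le_max; apply/andP; split; apply/orP; [left|right].
    rewrite /g addNr sub0r oppr_le0 mulr_ge0 ?(ltW h0)// sumr_ge0// => j _.
    have /andP[? _] := p0 j (- theta) (ltn_ord j).
    by have /andP[? _] := s01 j (ltn_ord j); rewrite mulr_ge0.
  rewrite /g subrK subr_ge0 ler_pM2l// ler_sum// => j _.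
  have /andP[p1 p2] := p0 j (B - theta) (ltn_ord j).
  have /andP[? ?] := s01 j (ltn_ord j).
  by apply: le_trans p2; rewrite ler_piMr.
exists (p^~ c) => j jN; rewrite (hp j jN).2; congr (F (s j) _).
have -> : c * (s j ^+ 2 / 2) =
    (- theta + quad N (p^~ c) (fun t => 1 - t)) * (s j ^+ 2 / 2).
  by congr (_ * _); move: gc0; rewrite /g; lra.
rewrite /quad /= -/h -/s.
have -> : \sum_(i < N.+1) p i c * green_prim (s j) (s i) =
  (s j ^+ 2 / 2) * (\sum_(i < N.+1) p i c * (1 - s i)) -
  (\sum_(i < j) ((s j - s i) ^+ 2 / 2) * p i c).
  rewrite mulr_sumr.
  (* The positive part vanishes for i >= j, which extends the sum to all nodes. *)
  have -> : \sum_(i < j) ((s j - s i) ^+ 2 / 2) * p i c =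
    \sum_(i < N.+1) (pospart (s j - s i) ^+ 2 / 2) * p i c.
    rewrite -(big_mkord xpredT (fun i => (s j - s i) ^+ 2 / 2 * p i c)).
    rewrite -(big_mkord xpredT (fun i => pospart (s j - s i) ^+ 2 / 2 * p i c)).
    rewrite (@big_cat_nat _ _ _ j 0 N.+1)//=; last exact: ltnW.
    rewrite [X in _ = _ + X]big_nat [X in _ = _ + X]big1 ?addr0; last first.
      move=> i /andP[ji _]; have [[e ->]|[_ ->]] := pospartP (s j) (s i);
        last by rewrite expr0n/= !mul0r.
      have -> : s i = s j by apply/eqP; rewrite eq_le e ler_node ji.
      by rewrite subrr expr0n/= !mul0r.
    rewrite [LHS]big_nat [RHS]big_nat; apply: eq_bigr => i /andP[_ ij].
    have [[_ ->]//|[]] := pospartP (s j) (s i).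
    by rewrite ltNge ler_node ltnW.
  by rewrite -sumrB; apply: eq_bigr => i _; rewrite /green_prim; ring.
have -> : \sum_(i < j) (- h * ((s j - s i) ^+ 2 / 2)) * p i c =
  - h * (\sum_(i < j) ((s j - s i) ^+ 2 / 2) * p i c).
  by rewrite mulr_sumr; apply: eq_bigr => i _; rewrite -mulrA.
by move: (\sum_(i < N.+1) _) => S1; move: (\sum_(i < j) _) => S2; field.
Qed.

(** Green's function is at most min(x, s) <= x^rho s^(1 - rho). The factor x^rho becomes the rate at
    which the slope reaches its value at 0, and the masses weighted by s^(1 - rho) must have the
    integrable bound C s^(-tau). *)
Definition tame (R : realType) (N : nat) (rho tau C : R) (p : nat -> R) : Prop :=
  forall j, (j < N.+1)%N -> 0 <= p j /\
    p j * node R N j `^ (1 - rho) <= C * node R N j `^ (- tau).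

Lemma quad_taylor (R : realType) (N : nat) (p : nat -> R) (k1 k2 k3 : R -> R) (c : R) :
  quad N p k1 - quad N p k2 - quad N p k3 * c =
  quad N p (fun s => k1 s - k2 s - k3 s * c).
Proof.
rewrite /quad -mulrBr -mulrA -mulrBr mulr_suml -!sumrB; congr (_ * _).
by apply: eq_bigr => j _; ring.
Qed.

Lemma quad_mulr (R : realType) (N : nat) (p : nat -> R) (k : R -> R) (c : R) :
  quad N p k * c = quad N p (fun s => k s * c).
Proof.
by rewrite /quad -mulrA mulr_suml; congr (_ * _); apply: eq_bigr => j _; rewrite mulrA.
Qed.

Lemma ler_norm_quad (R : realType) (N : nat) (p : nat -> R) (k m : R -> R) :
  (forall j, (j < N.+1)%N -> 0 <= p j) ->
  (forall s, 0 < s <= 1 -> `|k s| <= m s) -> `|quad N p k| <= quad N p m.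
Proof.
move=> p0 km; rewrite normrM (gtr0_norm (mesh_gt0 _ _)) ler_pM2l ?mesh_gt0//.
apply: le_trans (ler_norm_sum _ _ _) _; apply: ler_sum => j _.
rewrite normrM ger0_norm ?p0// ler_wpM2l ?p0// km// node_gt0 node_le1//.
Qed.

Lemma quad_itv (R : realType) (N : nat) (p : nat -> R) (k m : R -> R) :
  (forall j, (j < N.+1)%N -> 0 <= p j) ->
  (forall s, 0 < s <= 1 -> 0 <= k s <= m s) -> 0 <= quad N p k <= quad N p m.
Proof.
move=> p0 km; rewrite mulr_ge0 ?(ltW (mesh_gt0 _ _))//=; last first.
  apply: sumr_ge0 => j _; rewrite mulr_ge0 ?p0//.
  by have /andP[] := km _ (introT andP (conj (node_gt0 R N j) (node_le1 R (ltn_ord j)))).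
apply: le_trans (ler_norm _) (ler_norm_quad p0 _) => s s01.
by have /andP[k0 kms] := km s s01; rewrite ger0_norm.
Qed.

Lemma min_le_geometric_mean (R : realType) (rho x s : R) : 0 <= rho <= 1 ->
  0 < x -> 0 < s -> Num.min x s <= x `^ rho * s `^ (1 - rho).
Proof.
move=> /andP[r0 r1] x0 s0; have m0 : 0 < Num.min x s by rewrite lt_min x0.
have -> : Num.min x s = Num.min x s `^ rho * Num.min x s `^ (1 - rho).
  rewrite -powRD; last by rewrite (gt_eqF m0) implybT.
  by rewrite addrC subrK powRr1 ?ltW.
apply: ler_pM; rewrite ?powR_ge0//; apply: ge0_ler_powR;
  rewrite ?nnegrE ?(ltW m0) ?(ltW x0) ?(ltW s0) ?subr_ge0//.
  by rewrite ge_min lexx.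
by rewrite ge_min lexx orbT.
Qed.

(** The basic estimate uniform in the mesh: the minimum is split into x^rho and s^(1 - rho), and the
    remaining Riemann sum of s^(-tau) is bounded by its integral. *)
Lemma tame_quad_min (R : realType) (N : nat) (rho tau C x : R) (p : nat -> R) :
  0 <= rho <= 1 -> 0 <= tau < 1 -> 0 <= C -> tame N rho tau C p -> 0 < x ->
  quad N p (Num.min x) <= C / (1 - tau) * x `^ rho.
Proof.
move=> r01 t01 C0 tp x0.
apply: (@le_trans _ _ (C * x `^ rho * (mesh R N * \sum_(j < N.+1) node R N j `^ (- tau)))).
  rewrite /quad mulrCA ler_pM2l ?mesh_gt0// mulr_sumr; apply: ler_sum => j _.
  have [p0 pC] := tp j (ltn_ord j).
  apply: (@le_trans _ _ (p j * (x `^ rho * node R N j `^ (1 - rho)))).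
    by rewrite ler_wpM2l// min_le_geometric_mean// node_gt0.
  rewrite mulrCA -mulrA (mulrCA C) ler_wpM2l ?powR_ge0//.
rewrite mulrAC ler_wpM2r ?powR_ge0// ler_wpM2l//.
exact: riemann_sum_powR.
Qed.

(** A crude bound away from 0: on ]0, 1] one has s <= s^(1 - rho) and s^(-tau) <= 1 / s, hence p <=
    C / s^2. *)
Lemma tame_le (R : realType) (N : nat) (rho tau C d : R) (p : nat -> R) :
  0 <= rho -> 0 <= tau < 1 -> 0 <= C -> tame N rho tau C p -> 0 < d ->
  forall j, (j < N.+1)%N -> d <= node R N j -> p j <= C / d ^+ 2.
Proof.
move=> r0 /andP[t0 t1] C0 tp d0 j jN ds; have [p0 pC] := tp j jN.
move: pC ds (node_gt0 R N j) (node_le1 R jN); move: (node R N j) => s pC ds s0 s1.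
have h1 : s <= s `^ (1 - rho).
  by rewrite -{1}(powRr1 (ltW s0)); apply: ger_powR; [rewrite s0|lra].
have h2 : s `^ (- tau) <= s^-1.
  by rewrite -(powR_inv1 (ltW s0)); apply: ger_powR; [rewrite s0|lra].
have h3 : p j * s <= C / s.
  apply: le_trans (ler_wpM2l p0 h1) _; apply: le_trans pC _.
  by rewrite ler_wpM2l.
have h4 : p j <= C / s ^+ 2.
  by rewrite expr2 invfM mulrA ler_pdivlMr.
apply: le_trans h4 _; rewrite ler_wpM2l// lef_pV2 ?posrE ?exprn_gt0//.
by rewrite ler_pXn2r// nnegrE ltW.
Qed.

Lemma mesh_count_diff (R : realType) (N : nat) (x y : R) : 0 <= x <= 1 -> 0 <= y <= 1 ->
  `|mesh R N * \sum_(j < N.+1) ((node R N j <= y)%R%:R - (node R N j <= x)%R%:R) - (y - x)|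
   <= mesh R N.
Proof.
move=> x01 y01; rewrite sumrB mulrBr.
have /andP[] := mesh_count N x01; have /andP[] := mesh_count N y01.
by rewrite ler_norml => ? ? ? ?; apply/andP; split; lra.
Qed.

Lemma mesh_count_between (R : realType) (N : nat) (x y : R) : 0 <= x <= 1 -> 0 <= y <= 1 ->
  mesh R N * \sum_(j < N.+1) `|(node R N j <= y)%R%:R - (node R N j <= x)%R%:R|
   <= `|y - x| + mesh R N.
Proof.
wlog xy : x y / x <= y => [hw x01 y01|x01 y01].
  have [xy|/ltW xy] := leP x y; first exact: hw.
  rewrite distrC; under eq_bigr do rewrite distrC.
  exact: hw.
have := mesh_count_diff N x01 y01; rewrite ler_norml => /andP[_].
have -> : \sum_(j < N.+1) `|(node R N j <= y)%R%:R - (node R N j <= x)%R%:R| =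
  \sum_(j < N.+1) ((node R N j <= y)%R%:R - (node R N j <= x)%R%:R : R).
  apply: eq_bigr => j _; rewrite ger0_norm// subr_ge0 ler_nat.
  by case: (leP (node R N j) x) => // h; rewrite (le_trans h xy).
by rewrite (ger0_norm (_ : 0 <= y - x)) ?subr_ge0//; lra.
Qed.

(** The terms in [theta] solve the problem without masses. [disc_v] adds the response to the masses,
    [disc_H] is its primitive vanishing at 0, and [disc_q] is its right derivative, a step function
    jumping at the nodes. *)
Definition disc_H (R : realType) (theta : R) (N : nat) (p : nat -> R) (x : R) : R :=
  theta * (x - x ^+ 2 / 2) + quad N p (green_prim x).
Definition disc_v (R : realType) (theta : R) (N : nat) (p : nat -> R) (x : R) : R :=
  theta * (1 - x) + quad N p (green x).
Definition disc_q (R : realType) (theta : R) (N : nat) (p : nat -> R) (x : R) : R :=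
  - theta + quad N p (green_deriv x).

Lemma tame_quad_div (R : realType) (N : nat) (rho tau C d : R) (p : nat -> R) :
  0 <= rho <= 1 -> 0 <= tau < 1 -> 0 <= C -> tame N rho tau C p -> 0 < d ->
  quad N p (fun s => s / d) <= C / (1 - tau) / d.
Proof.
move=> r01 t01 C0 tp d0.
have -> : quad N p (fun s => s / d) = quad N p (Num.min 1) / d.
  rewrite /quad -mulrA mulr_suml; congr (_ * _); apply: eq_bigr => j _.
  by rewrite min_r ?node_le1// mulrA.
rewrite ler_pM2r ?invr_gt0//.
by have := tame_quad_min r01 t01 C0 tp ltr01; rewrite powR1 mulr1.
Qed.

Lemma disc_q_le (R : realType) (N : nat) (theta rho tau C d x : R) (p : nat -> R) :
  0 <= theta -> 0 <= rho <= 1 -> 0 <= tau < 1 -> 0 <= C -> tame N rho tau C p ->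
  0 < d <= x -> x <= 1 -> `|disc_q theta N p x| <= theta + C / (1 - tau) / d.
Proof.
move=> th0 r01 t01 C0 tp /andP[d0 dx] x1.
apply: le_trans (ler_normD _ _) _; rewrite normrN ger0_norm// lerD2l.
apply: le_trans (tame_quad_div r01 t01 C0 tp d0).
apply: ler_norm_quad => [j /tp[]//|s s01].
by apply: green_deriv_le => //; rewrite d0.
Qed.

Lemma disc_v_itv (R : realType) (N : nat) (theta rho tau C x : R) (p : nat -> R) :
  0 <= rho <= 1 -> 0 <= tau < 1 -> 0 <= C -> tame N rho tau C p ->
  0 < x <= 1 -> 0 <= disc_v theta N p x - theta * (1 - x) <= C / (1 - tau) * x `^ rho.
Proof.
move=> r01 t01 C0 tp /andP[x0 x1]; rewrite /disc_v (addrC (theta * _)) addrK.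
have p0 j : (j < N.+1)%N -> 0 <= p j by case/tp.
have /andP[-> h] := quad_itv p0 (fun s hs =>
  @green_itv R x s (introT andP (conj (ltW x0) x1)) hs).
by apply: le_trans h _; exact: tame_quad_min.
Qed.

Lemma disc_H_itv (R : realType) (N : nat) (theta rho tau C x : R) (p : nat -> R) :
  0 <= rho <= 1 -> 0 <= tau < 1 -> 0 <= C -> tame N rho tau C p ->
  0 < x <= 1 ->
  0 <= disc_H theta N p x - theta * (x - x ^+ 2 / 2) <= C / (1 - tau) * x `^ rho * x.
Proof.
move=> r01 t01 C0 tp /andP[x0 x1]; rewrite /disc_H (addrC (theta * _)) addrK.
have p0 j : (j < N.+1)%N -> 0 <= p j by case/tp.
have /andP[-> h] := quad_itv p0 (fun s hs =>
  @green_prim_itv R x s (introT andP (conj (ltW x0) x1)) hs).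
apply: le_trans h _.
have -> : quad N p (fun s => x * Num.min x s) = quad N p (Num.min x) * x.
  by rewrite quad_mulr /quad; congr (_ * _); apply: eq_bigr => j _; rewrite (mulrC x).
by rewrite ler_pM2r//; exact: tame_quad_min.
Qed.

Lemma disc_v1 (R : realType) (N : nat) (theta : R) (p : nat -> R) : disc_v theta N p 1 = 0.
Proof.
rewrite /disc_v subrr mulr0 add0r /quad big1 ?mulr0// => j _.
by rewrite /green /pospart max_r ?subr_ge0 ?node_le1// mul1r subrr mulr0.
Qed.

Lemma disc_H_taylor (R : realType) (N : nat) (theta rho tau C d x y : R) (p : nat -> R) :
  0 <= theta -> 0 <= rho <= 1 -> 0 <= tau < 1 -> 0 <= C -> tame N rho tau C p ->
  0 < d -> d <= x <= 1 -> d <= y ->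
  `|disc_H theta N p y - disc_H theta N p x - disc_v theta N p x * (y - x)| <=
  (theta + C / (1 - tau) / d) * (y - x) ^+ 2.
Proof.
move=> th0 r01 t01 C0 tp d0 x01 y01.
have -> : disc_H theta N p y - disc_H theta N p x - disc_v theta N p x * (y - x) =
  - (theta * (y - x) ^+ 2 / 2) + (quad N p (green_prim y) - quad N p (green_prim x) -
   quad N p (green x) * (y - x)) by rewrite /disc_H /disc_v; field.
have e0 : 0 <= theta * (y - x) ^+ 2 by rewrite mulr_ge0 ?sqr_ge0.
apply: le_trans (ler_normD _ _) _; rewrite mulrDl; apply: lerD.
  by rewrite normrN ger0_norm; lra.
apply: le_trans (ler_wpM2r (sqr_ge0 _) (tame_quad_div r01 t01 C0 tp d0)).
rewrite quad_taylor quad_mulr.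
apply: ler_norm_quad => [j /tp[]//|s s01].
exact: green_prim_taylor.
Qed.

(** Only nodes between x and y contribute. They lie beyond d, where the masses are bounded by
    [tame_le], and their number is controlled by [mesh_count_between]. *)
Lemma tame_quad_between (R : realType) (N : nat) (rho tau C d x y : R) (p : nat -> R) :
  0 <= rho -> 0 <= tau < 1 -> 0 <= C -> tame N rho tau C p ->
  0 < d -> d <= x <= 1 -> d <= y <= 1 ->
  quad N p (fun s => `|(s <= y)%R%:R - (s <= x)%R%:R|) <=
  C / d ^+ 2 * (`|y - x| + mesh R N).
Proof.
move=> r0 t01 C0 tp d0 /andP[dx x1] /andP[dy y1].
have B0 : 0 <= C / d ^+ 2 by rewrite divr_ge0// sqr_ge0.
apply: le_trans (ler_wpM2l B0 (@mesh_count_between R N x y _ _)); [|lra..].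
rewrite mulrCA /quad ler_pM2l ?mesh_gt0// mulr_sumr; apply: ler_sum => j _.
have [ds|sd] := leP d (node R N j).
  by rewrite ler_wpM2r//; exact: (tame_le r0 t01 C0 tp d0).
have -> : (node R N j <= x)%R by lra.
have -> : (node R N j <= y)%R by lra.
by rewrite subrr normr0 !mulr0.
Qed.

Lemma disc_v_taylor (R : realType) (N : nat) (theta rho tau C d x y : R) (p : nat -> R) :
  0 <= rho <= 1 -> 0 <= tau < 1 -> 0 <= C -> tame N rho tau C p ->
  0 < d -> d <= x <= 1 -> d <= y <= 1 ->
  `|disc_v theta N p y - disc_v theta N p x - disc_q theta N p x * (y - x)| <=
  C / d ^+ 2 * (`|y - x| + mesh R N) * `|y - x|.
Proof.
move=> /andP[r0 r1] t01 C0 tp d0 x01 y01.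
have -> : disc_v theta N p y - disc_v theta N p x - disc_q theta N p x * (y - x) =
  quad N p (green y) - quad N p (green x) - quad N p (green_deriv x) * (y - x).
  by rewrite /disc_v /disc_q; ring.
apply: le_trans (ler_wpM2r (normr_ge0 _) (tame_quad_between r0 t01 C0 tp d0 x01 y01)).
rewrite quad_taylor quad_mulr; apply: ler_norm_quad => [j /tp[]//|s s01].
exact: green_taylor.
Qed.

(** The increment of [disc_q] is minus the mass between x and y. Replacing the values [p j] there by
    [f] costs the term in [e], and replacing the node count by the length y - x costs the last
    term. *)
Lemma disc_q_taylor (R : realType) (N : nat) (theta x y f e : R) (p : nat -> R) :
  0 <= x <= 1 -> 0 <= y <= 1 -> 0 <= e ->
  (forall j, (j < N.+1)%N -> Num.min x y < node R N j <= Num.max x y -> `|p j - f| <= e) ->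
  `|disc_q theta N p y - disc_q theta N p x + f * (y - x)| <=
  e * (`|y - x| + mesh R N) + `|f| * mesh R N.
Proof.
move=> x01 y01 e0 pf.
pose c j : R := (node R N j <= y)%R%:R - (node R N j <= x)%R%:R.
have -> : disc_q theta N p y - disc_q theta N p x + f * (y - x) =
  - (mesh R N * \sum_(j < N.+1) (p j - f) * c j) - f * (mesh R N * \sum_(j < N.+1) c j - (y - x)).
  have -> : \sum_(j < N.+1) (p j - f) * c j = \sum_(j < N.+1) p j * c j - f * \sum_(j < N.+1) c j.
    by rewrite mulr_sumr -sumrB; apply: eq_bigr => j _; rewrite mulrBl.
  have -> : disc_q theta N p y - disc_q theta N p x = - (mesh R N * \sum_(j < N.+1) p j * c j).
    rewrite /disc_q /quad opprD addrACA subrr add0r -mulrBr -sumrB -mulrN -sumrN.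
    by congr (_ * _); apply: eq_bigr => j _; rewrite /green_deriv /c; ring.
  by ring.
apply: le_trans (ler_normB _ _) _; rewrite normrN; apply: lerD; last first.
  by rewrite normrM ler_wpM2l// mesh_count_diff.
apply: le_trans (ler_wpM2l e0 (mesh_count_between N x01 y01)).
rewrite normrM (gtr0_norm (mesh_gt0 _ _)) mulrCA ler_pM2l ?mesh_gt0//.
apply: le_trans (ler_norm_sum _ _ _) _; rewrite mulr_sumr; apply: ler_sum => j _.
rewrite normrM -/(c j); have [->|c0] := eqVneq (c j) 0; first by rewrite normr0 !mulr0.
rewrite ler_wpM2r//; apply: pf => //; move: c0; rewrite /c.
rewrite gt_min le_max.
by case: (leP (node R N j) x) => hx; case: (leP (node R N j) y) => hy; rewrite ?subrr ?eqxx ?orbT.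
Qed.

(** * Passage to the limit *)

Lemma ultra_fmap (T S : Type) (U : set_system T) (u : T -> S) :
  UltraFilter U -> UltraFilter (u x @[x --> U]).
Proof.
move=> UU; split=> [|G GF sG]; first exact: fmap_proper_filter.
rewrite predeqE => A; split=> [GA|]; last exact: sG.
have [//|UnA] := in_ultra_setVsetC (u @^-1` A) UU.
have GnA : G (~` A) by apply: sG.
by have := @filterI _ _ GF _ _ GA GnA; rewrite setICr => /filter_not_empty.
Qed.

Lemma ultra_bounded_cvg (R : realType) (U : set_system nat) (u : nat -> R) (M : R) :
  UltraFilter U -> (forall N, `|u N| <= M) -> exists l : R, u N @[N --> U] --> l.
Proof.
move=> UU uM; have := @segment_compact R (- M) M; rewrite compact_ultra.
move=> /(_ _ (ultra_fmap u UU)) [|l [_ ul]]; last by exists l.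
by apply: (@filterE _ U) => N /=; rewrite in_itv/= -ler_norml.
Qed.

(* Differentiability at [x] of a function of which only the values on ]0, 1]
   matter; the derivative is one-sided at 1. *)
Definition wderiv (R : realType) (u : R -> R) (x d : R) : Prop :=
  forall e : R, 0 < e -> exists2 eta : R, 0 < eta &
    forall y : R, 0 < y <= 1 -> `|y - x| < eta -> `|u y - u x - d * (y - x)| <= e * `|y - x|.

Lemma wderiv_quadratic (R : realType) (u : R -> R) (x d r L : R) : 0 < r -> 0 <= L ->
  (forall y : R, 0 < y <= 1 -> `|y - x| < r -> `|u y - u x - d * (y - x)|
    <= L * `|y - x| ^+ 2) ->
  wderiv u x d.
Proof.
move=> r0 L0 H e e0; exists (Num.min r (e / (L + 1))).
  by rewrite lt_min r0 divr_gt0//; lra.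
move=> y y01; rewrite lt_min => /andP[yr ye].
apply: le_trans (H y y01 yr) _; rewrite expr2 mulrA ler_wpM2r//.
move: ye; rewrite ltr_pdivlMr; last by lra.
by have := normr_ge0 (y - x); lra.
Qed.

(** A single ultrafilter yields the limits at all points simultaneously, without extraction of
    subsequences. *)
Lemma pointwise_ultra_limit (R : realType) (U : set_system nat) (u : nat -> R -> R) :
  UltraFilter U -> (forall x : R, 0 < x <= 1 -> exists M, forall N, `|u N x| <= M) ->
  exists f : R -> R, forall x : R, 0 < x <= 1 -> u N x @[N --> U] --> f x.
Proof.
move=> UU ub; exists (fun x => lim (u N x @[N --> U])) => x x01.
have [M uM] := ub x x01; have [l ul] := ultra_bounded_cvg UU uM.
by rewrite (_ : lim _ = l)//; exact: cvg_lim.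
Qed.

Lemma between_dist (R : realType) (x y s : R) :
  Num.min x y < s <= Num.max x y -> `|s - x| <= `|y - x|.
Proof.
rewrite gt_min le_max => /andP[/orP h1 /orP h2].
have [xy|/ltW xy] := leP x y.
  rewrite (ger0_norm (_ : 0 <= y - x)) ?subr_ge0//.
  by rewrite ger0_norm; case: h1 => ?; case: h2 => ?; lra.
rewrite (ler0_norm (_ : y - x <= 0)) ?subr_le0//.
by rewrite ler0_norm; case: h1 => ?; case: h2 => ?; lra.
Qed.

Lemma mesh_cvg0 (R : realType) : mesh R N @[N --> \oo] --> 0.
Proof. exact: cvg_harmonic. Qed.

(** The constants in the Taylor estimates do not depend on N, and the terms in the mesh size vanish
    in the limit, so the estimates survive as differentiability of the limits at every point of ]0,
    1], one-sided at 1. *)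
Lemma bvp_exists (R : realType) (theta rho tau C : R) (F : R -> R -> R) :
  0 <= theta -> 0 < rho <= 1 -> 0 <= tau < 1 -> 0 <= C ->
  (forall x h : R, 0 < x <= 1 -> {for (x, h), continuous (fun z : R * R => F z.1 z.2)}) ->
  (forall x h : R, 0 < x <= 1 -> 0 <= F x h /\ F x h * x `^ (1 - rho) <= C * x `^ (- tau)) ->
  exists H v q : R -> R, [/\
    forall x : R, 0 < x <= 1 ->
      0 <= H x - theta * (x - x ^+ 2 / 2) <= C / (1 - tau) * x `^ rho * x,
    forall x : R, 0 < x <= 1 -> 0 <= v x - theta * (1 - x) <= C / (1 - tau) * x `^ rho,
    v 1 = 0 &
    forall x : R, 0 < x <= 1 -> [/\ wderiv H x (v x), wderiv v x (q x) &
      wderiv q x (- F x (H x))]].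
Proof.
move=> th0 rho01 t01 C0 cF FC.
have r01 : 0 <= rho <= 1 by lra.
have [t0 t1] := andP t01.
set C' := C / (1 - tau).
have C'0 : 0 <= C' by rewrite divr_ge0//; lra.
have cFx x : 0 < x <= 1 -> continuous (F x).
  move=> x01 h.
  apply: (@continuous_comp _ _ _ (fun h : R => (x, h))
    (fun z : R * R => F z.1 z.2)); last exact: cF.
  exact: (@cvg_pair _ _ _ _ _ _ _ _ _ (fun=> x) id (cvg_cst _) cvg_id).
have /choice[p hp] N : exists p : nat -> R, tame N rho tau C p /\
    forall j, (j < N.+1)%N -> p j = F (node R N j) (disc_H theta N p (node R N j)).
  have nd j : (j < N.+1)%N -> 0 < node R N j <= 1 by move=> jN; rewrite node_gt0 node_le1.
  have [||p hp] := @discrete_profile R N theta F (fun s => C * s `^ (- tau) / s `^ (1 - rho)).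
  - by move=> j /nd; exact: cFx.
  - move=> j h /nd s01; have [-> h2] := FC _ h s01.
    by rewrite ler_pdivlMr// powR_gt0//; case/andP: s01.
  - exists p; split=> j jN; last exact: hp.
    by rewrite (hp j jN); apply: FC; exact: nd.
have [U [UU oU]] := @ultraFilterLemma nat \oo _.
have PU : ProperFilter U by exact: ultra_proper.
have m0 : mesh R N @[N --> U] --> 0 by apply: cvg_trans (@mesh_cvg0 R) => A /oU.
have vb N x : 0 < x <= 1 -> 0 <= disc_v theta N (p N) x - theta * (1 - x) <= C' * x `^ rho.
  by move=> x01; apply: disc_v_itv => //; exact: (hp N).1.
have Hb N x : 0 < x <= 1 ->
    0 <= disc_H theta N (p N) x - theta * (x - x ^+ 2 / 2) <= C' * x `^ rho * x.
  by move=> x01; apply: disc_H_itv => //; exact: (hp N).1.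
have [|H HU] := @pointwise_ultra_limit R U (fun N => disc_H theta N (p N)) UU.
  move=> x x01; exists (`|theta * (x - x ^+ 2 / 2)| + C' * x `^ rho * x) => N.
  have /andP[h1 h2] := Hb N x x01;
  have := ler_normD (disc_H theta N (p N) x - theta * (x - x ^+ 2 / 2))
    (theta * (x - x ^+ 2 / 2)).
  by rewrite subrK (ger0_norm h1); lra.
have [|v vU] := @pointwise_ultra_limit R U (fun N => disc_v theta N (p N)) UU.
  move=> x x01; exists (`|theta * (1 - x)| + C' * x `^ rho) => N.
  have /andP[h1 h2] := vb N x x01;
  have := ler_normD (disc_v theta N (p N) x - theta * (1 - x))
    (theta * (1 - x)).
  by rewrite subrK (ger0_norm h1); lra.
have [|q qU] := @pointwise_ultra_limit R U (fun N => disc_q theta N (p N)) UU.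
  move=> x /andP[x0 x1]; exists (theta + C' / x) => N.
  by apply: (disc_q_le th0 r01 t01 C0 (hp N).1); rewrite ?lexx ?andbT.
exists H, v, q; split.
- move=> x x01; apply/andP; split.
    rewrite subr_ge0; apply: (cvgr_to_ge (HU x x01)); apply: nearW => N.
    by rewrite -subr_ge0; case/andP: (Hb N x x01).
  rewrite lerBlDr; apply: (cvgr_to_le (HU x x01)); apply: nearW => N.
  by rewrite -lerBlDr; case/andP: (Hb N x x01).
- move=> x x01; apply/andP; split.
    rewrite subr_ge0; apply: (cvgr_to_ge (vU x x01)); apply: nearW => N.
    by rewrite -subr_ge0; case/andP: (vb N x x01).
  rewrite lerBlDr; apply: (cvgr_to_le (vU x x01)); apply: nearW => N.
  by rewrite -lerBlDr; case/andP: (vb N x x01).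
- have h : disc_v theta N (p N) 1 @[N --> U] --> v 1 by apply: vU; lra.
  apply/eqP; rewrite eq_le; apply/andP; split.
    by apply: (cvgr_to_le h); apply: nearW => N; rewrite disc_v1.
  by apply: (cvgr_to_ge h); apply: nearW => N; rewrite disc_v1.
move=> x x01; have [x0 x1] := andP x01.
(* Points closer to x than d stay beyond d, where the estimates have uniform constants. *)
pose d := x / 2; have d0 : 0 < d by rewrite /d; lra.
have dx : d <= x <= 1 by rewrite /d; lra.
have dy y : `|y - x| < d -> d <= y by rewrite ltr_norml /d; lra.
have L0 : 0 <= theta + C' / d by rewrite addr_ge0// divr_ge0// ltW.
have B0 : 0 <= C / d ^+ 2 by rewrite divr_ge0// sqr_ge0.
split.
- apply: (wderiv_quadratic d0 L0) => y y01 /dy dyy; rewrite real_normK ?num_real//.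
  apply: (@cvgr_to_le _ U _ _ (fun N =>
    `|disc_H theta N (p N) y - disc_H theta N (p N) x - disc_v theta N (p N) x * (y - x)|)).
    apply: cvg_norm; apply: cvgB; first by apply: cvgB; exact: HU.
    by apply: cvgM; [exact: vU|exact: cvg_cst].
  by apply: nearW => N; exact: (disc_H_taylor th0 r01 t01 C0 (hp N).1).
- apply: (wderiv_quadratic d0 B0) => y y01 /dy dyy.
  have dy1 : d <= y <= 1 by lra.
  apply: (@ler_cvg_to _ U _ _ (fun N =>
    `|disc_v theta N (p N) y - disc_v theta N (p N) x - disc_q theta N (p N) x * (y - x)|)
    (fun N => C / d ^+ 2 * (`|y - x| + mesh R N) * `|y - x|)).
  + apply: cvg_norm; apply: cvgB; first by apply: cvgB; exact: vU.
    by apply: cvgM; [exact: qU|exact: cvg_cst].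
  + rewrite [`|y - x| ^+ 2]expr2 mulrA; apply: cvgM; last exact: cvg_cst.
    apply: cvgM; first exact: cvg_cst.
    by rewrite -{2}[`|y - x|]addr0; apply: cvgD => //; exact: cvg_cst.
  + by apply: nearW => N; exact: (disc_v_taylor theta r01 t01 C0 (hp N).1 d0 dx dy1).
- move=> e e0.
  have /cvgrPdist_lt/(_ e e0) := cF x (H x) x01.
  move=> /nbhs_ballP[r /= r0 hr].
  (* [V] bounds the discrete slopes at x, and [L] is a Lipschitz constant, centred at x, of the
     discrete heights; neither depends on N. *)
  pose V := theta + C'; pose L := V + (theta + C' / d).
  have V0 : 0 <= V by rewrite /V addr_ge0.
  have L0' : 0 <= L by exact: addr_ge0.
  have LL0 : 0 < L + 2 by lra.
  (* The height at a node s differs from H x by at most L r / (L + 2), from the Lipschitz bound,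
     plus less than r / (L + 2), from convergence at x. The sum is below r, so F is within e of its
     value at (x, H x). *)
  exists (Num.min d (r / (L + 2))); first by rewrite lt_min d0 divr_gt0.
  move=> y y01; rewrite lt_min => /andP[/dy dyy yr].
  have dy1 : d <= y <= 1 by lra.
  apply: (@ler_cvg_to _ U _ _ (fun N =>
    `|disc_q theta N (p N) y - disc_q theta N (p N) x + F x (H x) * (y - x)|)
    (fun N => e * (`|y - x| + mesh R N) + `|F x (H x)| * mesh R N)).
  + apply: cvg_norm; rewrite mulNr opprK; apply: cvgD; last exact: cvg_cst.
    by apply: cvgB; exact: qU.
  + rewrite -[X in _ --> X]addr0; apply: cvgD.
      apply: cvgM; first exact: cvg_cst.
      by rewrite -{2}[`|y - x|]addr0; apply: cvgD => //; exact: cvg_cst.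
    by rewrite -(mulr0 `|F x (H x)|); apply: cvgM => //; exact: cvg_cst.
  + have r2 : 0 < r / (L + 2) by rewrite divr_gt0.
    have /cvgrPdist_lt/(_ _ r2) := HU x x01.
    apply: filterS => N hN; apply: disc_q_taylor; [lra|lra|exact: ltW|].
    move=> j jN jxy; have sj := node_gt0 R N j; have sj1 := node_le1 R jN.
    have [_ ->] := hp N => //; move: jxy sj sj1; move: (node R N j) => s jxy s0 s1.
    have ds : d <= s.
      move: jxy; rewrite gt_min => /andP[/orP[h|h] _]; lra.
    have sx : `|s - x| <= `|y - x| by exact: between_dist.
    have sx1 : `|s - x| <= 1 by rewrite ler_norml; lra.
    rewrite distrC ltW//; apply: (hr (s, disc_H theta N (p N) s)); split => /=.
      rewrite /ball/= distrC (le_lt_trans sx)// (lt_le_trans yr)//.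
      by rewrite ler_pdivrMr// ler_peMr// ?(ltW r0)//; lra.
    rewrite /ball/=.
    have h1 : `|disc_H theta N (p N) s - disc_H theta N (p N) x| <= L * `|s - x|.
      have := disc_H_taylor th0 r01 t01 C0 (hp N).1 d0 dx ds.
      have hv : `|disc_v theta N (p N) x| <= V.
        have /andP[v1 v2] := vb N x x01.
        have x01' : 0 <= theta * (1 - x) <= theta.
          by rewrite mulr_ge0//= ?ler_piMr//; lra.
        have xr : C' * x `^ rho <= C'.
          have : x `^ rho <= 1 `^ rho by apply: ge0_ler_powR; rewrite ?nnegrE//; lra.
          by rewrite powR1; exact: ler_piMr.
        by rewrite ler_norml /V; lra.
      set A := disc_H _ _ _ s - _; set w := disc_v _ _ _ x in hv *.
      move=> h; have -> : A = (A - w * (s - x)) + w * (s - x) by ring.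
      apply: le_trans (ler_normD _ _) _; rewrite normrM.
      rewrite [leRHS](_ : _ = (theta + C' / d) * `|s - x| + V * `|s - x|);
        last by rewrite /L; ring.
      apply: lerD; last by rewrite ler_wpM2r.
      apply: le_trans h _; rewrite -/C' ler_wpM2l// -[leLHS]ger0_norm ?sqr_ge0// normrX.
      by rewrite expr2 ler_piMr.
    have -> : H x - disc_H theta N (p N) s =
      (H x - disc_H theta N (p N) x) -
      (disc_H theta N (p N) s - disc_H theta N (p N) x) by ring.
    apply: le_lt_trans (ler_normB _ _) _.
    have h2 : L * `|s - x| <= L * (r / (L + 2)).
      by rewrite ler_wpM2l// (le_trans sx (ltW yr)).
    have h3 : r = L * (r / (L + 2)) + 2 * (r / (L + 2)) by rewrite -mulrDl mulrC divfK// gt_eqF.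
    lra.
Qed.

(** The filter is left general to serve both the two-sided derivative inside the interval and the
    left derivative at 1. *)
Lemma wderiv_quotient_cvg (R : realType) (u : R -> R) (x d : R) (F : set_system R)
    (FF : Filter F) : 0 < x <= 1 -> wderiv u x d ->
  F --> (0 : R)^' -> (\forall h \near F, 0 < h + x <= 1) ->
  h^-1 *: (u (h + x) - u x) @[h --> F] --> d.
Proof.
move=> x01 ud F0 Fx; apply/cvgrPdist_le => e e0; have [r r0 hr] := ud e e0.
have Fr : \forall h \near F, `|h| < r. apply: F0. by exact: (@dnbhs0_lt _ R).
have Fn : \forall h \near F, h != 0 by apply: F0; exact: (@nbhs_dnbhs_neq R 0).
near=> h.
have hx : 0 < h + x <= 1 by near: h.
have hn : h != 0 by near: h.
have := hr (h + x) hx; rewrite addrK => /(_ _)/wrap[]; first by near: h.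
move=> le; rewrite -[in leLHS](mulfK hn d) distrC.
have -> : h^-1 *: (u (h + x) - u x) - d * h / h = (u (h + x) - u x - d * h) / h.
  by rewrite /GRing.scale/= [LHS]addrC mulrBl [RHS]addrC (mulrC h^-1).
by rewrite normrM normfV ler_pdivrMr ?normr_gt0.
Unshelve. all: by end_near. Qed.

Lemma wderiv_is_derive (R : realType) (u : R -> R) (x d : R) :
  0 < x < 1 -> wderiv u x d -> is_derive x 1 u d.
Proof.
move=> x01 ud.
have ucvg : h^-1 *: (u (h *: 1 + x) - u x) @[h --> (0 : R)^'] --> d.
  under eq_cvg do rewrite /GRing.scale/= mulr1.
  apply: (@wderiv_quotient_cvg R u x d 0^' _ _ ud); [lra|exact: cvg_id|].
  have x0 : 0 < Num.min x (1 - x) by rewrite lt_min; apply/andP; split; lra.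
  apply: filterS (dnbhs0_lt x0) => h.
  by rewrite lt_min !ltr_norml => /andP[? ?]; lra.
by split; [apply/cvg_ex; exists d|exact: cvg_lim].
Qed.

Lemma at_left_sub_dnbhs (R : realType) (x : R) : x^'- --> x^'.
Proof.
by apply: within_subset => y /= yx; rewrite lt_eqF.
Qed.

Lemma wderiv_left (R : realType) (u : R -> R) (d : R) : wderiv u 1 d ->
  h^-1 *: (u (1 + h) - u 1) @[h --> (0 : R)^'-] --> d.
Proof.
move=> ud; under eq_cvg do rewrite (addrC 1).
apply: (@wderiv_quotient_cvg R u 1 d 0^'- _ _ ud); [lra|exact: at_left_sub_dnbhs|].
near=> h; have h0 : h < 0 by near: h; exact: nbhs_left_lt.
have : -1 < h by near: h; apply: nbhs_left_gt; lra.
lra.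
Unshelve. all: by end_near. Qed.

Lemma left_derivable_cvg (R : realType) (u : R -> R) (d : R) :
  h^-1 *: (u (1 + h) - u 1) @[h --> (0 : R)^'-] --> d -> u t @[t --> 1^'-] --> u 1.
Proof.
move=> ud.
have h0 : h @[h --> (0 : R)^'-] --> (0 : R) by apply: cvg_at_left_filter; exact: cvg_id.
have uh : u (1 + h) @[h --> (0 : R)^'-] --> u 1.
  have : h * (h^-1 *: (u (1 + h) - u 1)) + u 1 @[h --> (0 : R)^'-] --> 0 * d + u 1.
    by apply: cvgD; [exact: cvgM|exact: cvg_cst].
  rewrite mul0r add0r; apply: cvg_trans; apply: near_eq_cvg.
  near=> h; have hn : h != 0 by rewrite lt_eqF//; near: h; exact: nbhs_left_lt.
  by rewrite /GRing.scale/= mulrA divff// mul1r subrK.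
have s : (t - 1) @[t --> (1 : R)^'-] --> (0 : R)^'-.
  move=> A /nbhs_ballP[e /= e0 eA]; apply/nbhs_ballP; exists e => //= t te t1.
  by apply: eA; rewrite ?subr_lt0//= /ball/= sub0r opprB.
have := cvg_comp _ _ s uh; apply: cvg_trans; apply: near_eq_cvg.
by apply: nearW => t /=; rewrite addrC subrK.
Unshelve. all: by end_near. Qed.

Lemma cvg_mx_coord (R : realType) (T : Type) (F : set_system T) (FF : Filter F) (m n : nat)
    (f : T -> 'M[R]_(m, n)) (l : 'M[R]_(m, n)) :
  (forall i j, f x i j @[x --> F] --> l i j) -> f x @[x --> F] --> l.
Proof.
move=> fl; apply/cvgrPdist_le => e e0; near=> x.
rewrite /Num.Def.normr/= mx_normrE (bigmax_le _ (ltW e0))//= => i _.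
rewrite !mxE/=; move: i; near: x; apply: filter_forall => /= i.
exact: ((cvgrPdist_le _ _).1 (fl i.1 i.2)).
Unshelve. all: by end_near. Qed.

Lemma is_derive_coord (R : realType) (m n : nat) (g : R -> 'M[R]_(m, n)) (t : R)
    (d : 'M[R]_(m, n)) (i : 'I_m) (j : 'I_n) :
  is_derive t 1 g d -> is_derive t 1 (fun s => g s i j) (d i j).
Proof.
move=> [dg <-]; split; first by have := derivable_mxP g t 1; case=> /(_ dg).
by rewrite derive_mx// mxE.
Qed.

Lemma is_derive_mx (R : realType) (m n : nat) (g : R -> 'M[R]_(m, n)) (t : R)
    (d : 'M[R]_(m, n)) :
  (forall i j, is_derive t 1 (fun s => g s i j) (d i j)) -> is_derive t 1 g d.
Proof.
move=> dg; have dg' : derivable g t 1 by apply/derivable_mxP => i j; case: (dg i j).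
split=> //; rewrite derive_mx//; apply/matrixP => i j; rewrite mxE.
by case: (dg i j).
Qed.

(** * Existence *)

Lemma orbit_of_wderiv (R : realType) (n theta : R) (H v q : R -> R) :
  (forall x : R, 0 < x <= 1 -> [/\ wderiv H x (v x), wderiv v x (q x) &
    wderiv q x (H x `^ (1 - n) * (x - 1))]) ->
  (forall x : R, 0 < x < 1 -> 0 < H x) -> v 1 = 0 ->
  H x @[x --> 0^'+] --> 0 -> v x @[x --> 0^'+] --> theta ->
  exists g : R -> 'cV[R]_4, connecting_orbit n theta g.
Proof.
move=> D H0 v1 Hl vl.
pose g (t : R) : 'cV[R]_4 := \col_(i < 4) [:: t; H t; v t; q t]`_i.
have gx t : coord_x (g t) = t by rewrite /coord_x mxE.
have gH t : coord_H (g t) = H t by rewrite /coord_H mxE.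
have gv t : coord_dH (g t) = v t by rewrite /coord_dH mxE.
have gq t : coord_ddH (g t) = q t by rewrite /coord_ddH mxE.
have W (t : R) (i : 'I_4) : 0 < t <= 1 ->
    wderiv (fun s => [:: s; H s; v s; q s]`_i) t (vector_field n (g t) i 0).
  move=> t01; rewrite mxE gx gH gv gq; have [D1 D2 D3] := D t t01.
  case: i => -[|[|[|[|//]]]] //= _ e e0; exists 1 => // y _ _.
  by rewrite mul1r subrr normr0 mulr_ge0// ltW.
have gi (i : 'I_4) (j : 'I_1) : (fun s => g s i j) = (fun s => [:: s; H s; v s; q s]`_i).
  by apply/funext => s; rewrite mxE.
exists g; split.
- split.
  + by move=> t t01; rewrite gH; exact: H0.
  + move=> t t01; apply: is_derive_mx => i j; rewrite gi (ord1 j).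
    by apply: wderiv_is_derive => //; apply: W; lra.
  + apply: cvg_mx_coord => i j; rewrite (ord1 j).
    have := @wderiv_left R (fun s => [:: s; H s; v s; q s]`_i) _ (W 1 i _).
    move=> /(_ _)/wrap[]; first by lra.
    apply: cvg_trans; apply: near_eq_cvg; apply: nearW => h.
    by rewrite [RHS]mxE [in RHS]mxE [X in _ = _ * (_ + X)]mxE !mxE.
- by move=> t _; rewrite gx.
- split.
  + under eq_cvg do rewrite gx; apply: cvg_at_right_filter; exact: cvg_id.
  + by under eq_cvg do rewrite gH.
  + by under eq_cvg do rewrite gv.
- by split; [rewrite gx|rewrite gv].
Qed.

(** Clamping keeps the base of the power above [m x] > 0, which makes the right-hand side
    continuous, and below [M x], which makes it dominated independently of h. *)
Definition clamped_rhs (R : realType) (n : R) (m M : R -> R) (x h : R) : R :=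
  (1 - x) * Num.min (Num.max h (m x)) (M x) `^ (1 - n).

Lemma clamped_rhs_continuous (R : realType) (n x h : R) (m M : R -> R) :
  continuous m -> continuous M -> 0 < m x <= M x ->
  {for (x, h), continuous (fun z : R * R => clamped_rhs n m M z.1 z.2)}.
Proof.
move=> cm cM /andP[m0 mM].
have c1 : {for (x, h), continuous (fun z : R * R => z.1)} by exact: cvg_fst.
have c2 : {for (x, h), continuous (fun z : R * R => z.2)} by exact: cvg_snd.
apply: (@cvgM _ _ _ _ (fun z : R * R => 1 - z.1)
  (fun z : R * R => Num.min (Num.max z.2 (m z.1)) (M z.1) `^ (1 - n))).
  by apply: cvgB; [exact: cvg_cst|exact: c1].
have cm1 : {for (x, h), continuous (fun z : R * R => m z.1)}.
  by apply: (@continuous_comp _ _ _ fst m); [exact: c1|exact: cm].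
have cM1 : {for (x, h), continuous (fun z : R * R => M z.1)}.
  by apply: (@continuous_comp _ _ _ fst M); [exact: c1|exact: cM].
pose k (z : R * R) := Num.min (Num.max z.2 (m z.1)) (M z.1).
have ck : {for (x, h), continuous k}.
  by apply: continuous_min => //; exact: continuous_max.
apply: (@continuous_comp _ _ _ k (@powR R ^~ (1 - n))) => //.
apply: (@is_derive_cvg _ _ _ ((1 - n) * k (x, h) `^ (1 - n - 1))).
apply: is_derive1_powR; rewrite /k lt_min lt_max m0 orbT/=.
exact: lt_le_trans m0 mM.
Qed.

(** The last hypothesis is the a priori estimate: solutions of the clamped problem stay between the
    barriers. There the clamp is inactive, so the clamped solution solves the original equation. *)
Lemma clamped_orbit (R : realType) (n theta rho tau C : R) (m M : R -> R) :
  0 <= theta -> 0 < rho <= 1 -> 0 <= tau < 1 -> 0 <= C ->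
  continuous m -> continuous M -> (forall x : R, 0 < x <= 1 -> 0 < m x <= M x) ->
  (forall x h : R, 0 < x <= 1 -> m x <= h <= M x ->
    h `^ (1 - n) * x `^ (1 - rho) <= C * x `^ (- tau)) ->
  (forall H v q : R -> R,
    (forall x : R, 0 < x <= 1 ->
      0 <= H x - theta * (x - x ^+ 2 / 2) <= C / (1 - tau) * x `^ rho * x) ->
    (forall x : R, 0 < x < 1 -> [/\ is_derive x 1 H (v x), is_derive x 1 v (q x) &
      is_derive x 1 q (- clamped_rhs n m M x (H x))]) ->
    H x @[x --> 0^'+] --> 0 -> v x @[x --> 0^'+] --> theta -> v x @[x --> 1^'-] --> 0 ->
    forall x : R, 0 < x < 1 -> m x <= H x <= M x) ->
  exists g : R -> 'cV[R]_4, connecting_orbit n theta g.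
Proof.
move=> th0 r01 t01 C0 cm cM mM hC Hin.
have [r0 r1] := andP r01.
have clampP (x h : R) : 0 < x <= 1 -> m x <= Num.min (Num.max h (m x)) (M x) <= M x.
  by move=> /mM /andP[_ mMx]; rewrite le_min le_max lexx orbT mMx ge_min lexx orbT.
have [|x h x01|H [v [q [Hb vb v1 D]]]] :=
  @bvp_exists R theta rho tau C (clamped_rhs n m M) th0 r01 t01 C0.
- by move=> x h /mM ?; exact: clamped_rhs_continuous.
- have x1 : 0 <= 1 - x <= 1 by lra.
  split; first by rewrite /clamped_rhs mulr_ge0 ?powR_ge0//; case/andP: x1.
  rewrite /clamped_rhs; apply: le_trans (hC x _ x01 (clampP x h x01)).
  rewrite -mulrA ler_piMl//; last by case/andP: x1.
  by rewrite mulr_ge0 ?powR_ge0.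
have small : C / (1 - tau) * x `^ rho @[x --> (0 : R)^'+] --> (0 : R).
  rewrite -[X in _ --> X](mulr0 (C / (1 - tau))).
  by apply: cvgM; [exact: cvg_cst|exact: powR_cvg0].
have x0 : x @[x --> (0 : R)^'+] --> (0 : R) by apply: cvg_at_right_filter; exact: cvg_id.
have near01 : \forall x \near (0 : R)^'+, 0 < x <= 1.
  by near=> x; apply/andP; split => //; near: x; exact: nbhs_right_le.
have tl : theta * (x - x ^+ 2 / 2) @[x --> (0 : R)^'+] --> 0.
  rewrite -[X in _ --> X](_ : theta * (0 - 0 ^+ 2 * 2^-1) = 0); last by ring.
  apply: cvgM; first exact: cvg_cst.
  apply: cvgB => //; apply: cvgM; last exact: cvg_cst.
  by apply: cvg_at_right_filter; exact: exprn_continuous.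
have Hl : H x @[x --> 0^'+] --> 0.
  apply: (@squeeze_cvgr _ _ _ _ (fun x => theta * (x - x ^+ 2 / 2))
    (fun x => C / (1 - tau) * x `^ rho * x + theta * (x - x ^+ 2 / 2))) => //; last first.
    rewrite -[X in _ --> X](_ : 0 * 0 + 0 = 0); last by ring.
    by apply: cvgD => //; exact: cvgM.
  by apply: filterS near01 => x /Hb; rewrite subr_ge0 lerBlDr.
have vl : v x @[x --> 0^'+] --> theta.
  have tl' : theta * (1 - x) @[x --> (0 : R)^'+] --> theta.
    rewrite -[X in _ --> X](_ : theta * (1 - 0) = theta); last by ring.
    by apply: cvgM; [exact: cvg_cst|apply: cvgB => //; exact: cvg_cst].
  apply: (@squeeze_cvgr _ _ _ _ (fun x => theta * (1 - x))
    (fun x => C / (1 - tau) * x `^ rho + theta * (1 - x))) => //; last first.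
    by rewrite -[X in _ --> X]add0r; exact: cvgD.
  by apply: filterS near01 => x /vb; rewrite subr_ge0 lerBlDr.
have vr : v x @[x --> 1^'-] --> 0.
  rewrite -v1; have [|_ v1' _] := D 1; first lra.
  exact: left_derivable_cvg (wderiv_left v1').
have Hm x : 0 < x < 1 -> m x <= H x <= M x.
  apply: (Hin H v q) => // {}x x01; have [|D1 D2 D3] := D x; first lra.
  by split; exact: wderiv_is_derive.
apply: (@orbit_of_wderiv R n theta H v q) => // x x01; last first.
  have [|m0 _] := andP (mM x _); first lra.
  by have /andP[h _] := Hm x x01; exact: lt_le_trans m0 h.
have [D1 D2 D3] := D x x01; split => //.
rewrite (_ : _ * _ = - clamped_rhs n m M x (H x))// /clamped_rhs.
(* At x = 1 both sides vanish because of the factor x - 1, so the barriers are needed only on ]0,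
   1[. *)
have [->|xn1] := eqVneq x 1; first by rewrite !subrr mul0r mulr0 oppr0.
have x1 : x < 1 by rewrite lt_neqAle xn1; case/andP: x01.
have /andP[h1 h2] : m x <= H x <= M x by apply: Hm; lra.
by rewrite max_l// min_l// -[x - 1]opprB mulrN mulrC.
Unshelve. all: by end_near. Qed.

(** The lower barrier is the solution with zero right-hand side, below every solution because
    Green's function is nonnegative. The upper barrier is a constant [M0]. *)
Lemma orbit_exists_pos (R : realType) (n theta : R) : 0 < theta -> 0 < n < 3 ->
  exists g : R -> 'cV[R]_4, connecting_orbit n theta g.
Proof.
move=> th0 /andP[n0 n3].
pose m (x : R) := theta * (x - x ^+ 2 / 2).
have cm : continuous m.
  move=> x; apply: cvgM; first exact: cvg_cst.
  apply: cvgB; first exact: cvg_id.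
  by apply: cvgM; [exact: exprn_continuous|exact: cvg_cst].
have mge x : 0 < x <= 1 -> theta / 2 * x <= m x.
  move=> x01; rewrite /m -mulrA ler_pM2l//; nra.
have m0 x : 0 < x <= 1 -> 0 < m x.
  by move=> x01; apply: lt_le_trans (mge x x01); rewrite mulr_gt0//; lra.
have mle x : 0 < x <= 1 -> m x <= theta.
  by move=> x01; rewrite /m ger_pMr//; have := sqr_ge0 x; lra.
have suffice (rho tau C M0 : R) : 0 < rho <= 1 -> 0 <= tau < 1 -> 0 <= C ->
    theta + C / (1 - tau) <= M0 ->
    (forall x h : R, 0 < x <= 1 -> m x <= h <= M0 ->
      h `^ (1 - n) * x `^ (1 - rho) <= C * x `^ (- tau)) ->
    exists g : R -> 'cV[R]_4, connecting_orbit n theta g.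
  move=> r01 t01 C0 hM0 hC.
  have Ct : 0 <= C / (1 - tau) by rewrite divr_ge0//; lra.
  apply: (@clamped_orbit R n theta rho tau C m (fun=> M0)) => //; first exact: ltW.
  - by move=> x; exact: cvg_cst.
  - by move=> x x01; rewrite m0//=; apply: le_trans (mle x x01) _; lra.
  - move=> H v q Hb _ _ _ _ x x01.
    have x01' : 0 < x <= 1 by lra.
    have /andP[h1 h2] := Hb x x01'.
    rewrite -subr_ge0 h1/=; have := mle x x01'; rewrite /m.
    have xr : x `^ rho <= 1.
      have : x `^ rho <= 1 `^ rho by apply: ge0_ler_powR; rewrite ?nnegrE//; lra.
      by rewrite powR1.
    have : C / (1 - tau) * x `^ rho * x <= C / (1 - tau).
      rewrite -mulrA ler_piMr// -[leRHS]mulr1 ler_pM ?powR_ge0//; lra.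
    lra.
have [n1|n1] := ltP n 1.
  (* The requirement is theta + M0^(1 - n) <= M0. Here M0 >= 2 theta, and M0^n >= 2 gives M0^(1 - n)
     <= M0 / 2. *)
  pose M0 := 2 * theta + 2 `^ n^-1.
  have M00 : 0 < M0 by rewrite addr_gt0 ?powR_gt0// mulr_gt0.
  apply: (suffice 1 0 (M0 `^ (1 - n)) M0); [lra|lra|exact: powR_ge0| |].
    have h : 2 <= M0 `^ n.
      have {1}-> : 2 = (2 `^ n^-1) `^ n :> R by rewrite -powRrM mulVf ?powRr1//; lra.
      apply: ge0_ler_powR; rewrite ?nnegrE ?powR_ge0//; [lra|lra|].
      by rewrite /M0; lra.
    have e : M0 `^ (1 - n) * M0 `^ n = M0.
      by rewrite -powRD ?(gt_eqF M00) ?implybT// subrK powRr1// ltW.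
    have hM : 2 * theta <= M0 by rewrite lerDl powR_ge0.
    have : M0 `^ (1 - n) * 2 <= M0 by rewrite -[leRHS]e ler_wpM2l// powR_ge0.
    by rewrite subr0 divr1; lra.
  move=> x h x01 /andP[h1 h2]; rewrite subrr oppr0 !powRr0 !mulr1.
  have h0 : 0 < h by apply: lt_le_trans (m0 x x01) h1.
  by apply: ge0_ler_powR => //; rewrite ?nnegrE ?subr_ge0// ltW.
(* Since h >= theta x / 2, the power is at most a multiple of x^(1 - n). The exponents satisfy 1 - n
   + (1 - rho) = -tau, and n < 3 gives both rho > 0 and tau < 1. *)
apply: (suffice ((3 - n) / 2) ((n - 1) / 2) ((theta / 2) `^ (1 - n)) _ _ _ _ (lexx _));
  [lra|lra|exact: powR_ge0|].
move=> x h x01 /andP[h1 h2]; have /andP[x0 x1] := x01.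
have t2 : 0 < theta / 2 by lra.
have e1 : h `^ (1 - n) <= (theta / 2) `^ (1 - n) * x `^ (1 - n).
  rewrite -powRM ?(ltW t2) ?(ltW x0)//; apply: le0_ler_powR; [lra|exact: mulr_gt0|].
  exact: le_trans (mge x x01) h1.
apply: le_trans (ler_wpM2r (powR_ge0 _ _) e1) _.
rewrite -mulrA -powRD; last by rewrite (gt_eqF x0) implybT.
by rewrite (_ : 1 - n + _ = - ((n - 1) / 2))//; field.
Qed.

(* [sextic] solves H''' = -(1 - x) x^2, H(0) = H'(0) = H'(1) = 0. *)
Definition sextic (R : realType) (x : R) : R :=
  x ^+ 2 / 60 - x ^+ 5 / 60 + x ^+ 6 / 120.

(** H - k [sextic] has third derivative k (1 - x) x^2 - f <= 0 and zero boundary limits, so the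
    comparison principle applies. *)
Lemma sextic_comparison (R : realType) (k : R) (H v q f : R -> R) :
  (forall x : R, 0 < x < 1 -> [/\ is_derive x 1 H (v x), is_derive x 1 v (q x) &
      is_derive x 1 q (- f x)]) ->
  H x @[x --> 0^'+] --> 0 -> v x @[x --> 0^'+] --> 0 -> v x @[x --> 1^'-] --> 0 ->
  (forall x : R, 0 < x < 1 -> k * ((1 - x) * x ^+ 2) <= f x) ->
  forall x : R, 0 < x < 1 -> k * sextic x <= H x.
Proof.
move=> D H0 v0 v1 kf.
(* A family of three-term polynomials containing [sextic] and its first two derivatives, so that one
   rule differentiates them; [dQ2] is separate because of the constant term of [Q2]. *)
pose L (j2 j5 j6 : R) (a b c : nat) (x : R) := j2 * x ^+ a + 1 * (j5 * x ^+ b + j6 * x ^+ c).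
have dL (j2 j5 j6 x : R) (a b c : nat) : is_derive x 1 (L j2 j5 j6 a.+1 b.+1 c.+1)
    (L (j2 * a.+1%:R) (j5 * b.+1%:R) (j6 * c.+1%:R) a b c x).
  have := is_derive_lin j2 1 (is_derive_monomial x a)
    (is_derive_lin j5 j6 (is_derive_monomial x b) (is_derive_monomial x c)).
  by apply: is_derive_ext => //; rewrite /L !mulrA.
have cL (j2 j5 j6 x : R) (a b c : nat) : L j2 j5 j6 a b c t @[t --> x] --> L j2 j5 j6 a b c x.
  apply: cvg_lin; first exact: exprn_continuous.
  by apply: cvg_lin; exact: exprn_continuous.
pose Q0 := L (60^-1) (- 60^-1) (120^-1) 2 5 6.
pose Q1 := L (60^-1 * 2%:R) (- 60^-1 * 5%:R) (120^-1 * 6%:R) 1 4 5.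
pose Q2 := L (60^-1 * 2%:R * 1%:R) (- 60^-1 * 5%:R * 4%:R) (120^-1 * 6%:R * 5%:R) 0 3 4.
pose Q3 (x : R) := - ((1 - x) * x ^+ 2).
have dQ2 (x : R) : is_derive x 1 Q2 (Q3 x).
  have := is_derive_lin (- 60^-1 * 5%:R * 4%:R) (120^-1 * 6%:R * 5%:R)
    (is_derive_monomial x 2) (is_derive_monomial x 3).
  have := is_derive_cst (60^-1 * 2%:R * 1%:R : R) x 1 => /is_deriveD h /h.
  apply: is_derive_ext; last by rewrite /Q3; field.
  by apply/funext => t; rewrite /Q2 /L /= [RHS]addrC mul1r expr0 mulr1 addrC.
suff : forall x : R, 0 < x < 1 -> 0 <= 1 * H x + (- k) * Q0 x.
  move=> h x /h; rewrite /Q0 /L /sextic; lra.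
apply: (@concave_primitive_ge0 _ _ 0 0 _ (fun x => 1 * v x + (- k) * Q1 x)
   (fun x => 1 * q x + (- k) * Q2 x)) => //.
- by move=> x /D[d1 _ _]; apply: is_derive_lin => //; exact: dL.
- by move=> x /D[_ d1 _]; apply: is_derive_lin => //; exact: dL.
- apply: (@nonincreasing_oo _ _ _ _ (fun x => 1 * (- f x) + (- k) * Q3 x)).
    by move=> x /D[_ _ d1]; apply: is_derive_lin.
  by move=> x x01; have := kf x x01; rewrite /Q3; lra.
- rewrite -[X in _ --> X](_ : 1 * 0 + - k * Q0 0 = 0); last by rewrite /Q0 /L; ring.
  by apply: cvg_lin => //; apply: cvg_at_right_filter; exact: cL.
- rewrite -[X in _ --> X](_ : 1 * 0 + - k * Q1 0 = 0); last by rewrite /Q1 /L; ring.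
  by apply: cvg_lin => //; apply: cvg_at_right_filter; exact: cL.
- rewrite -[X in _ --> X](_ : 1 * 0 + - k * Q1 1 = 0); last by rewrite /Q1 /L; field.
  by apply: cvg_lin => //; apply: cvg_at_left_filter; exact: cL.
Qed.

Lemma sextic_ge (R : realType) (x : R) : 0 < x < 1 -> x ^+ 2 / 120 <= sextic x.
Proof.
move=> x01; have -> : sextic x = x ^+ 2 / 120 + x ^+ 2 / 120 * (1 - x ^+ 3 + x ^+ 3 * (x - 1)).
  by rewrite /sextic; field.
rewrite lerDl mulr_ge0//; first by rewrite divr_ge0// sqr_ge0.
have -> : 1 - x ^+ 3 + x ^+ 3 * (x - 1) = (1 - x) * (1 + x + x ^+ 2 - x ^+ 3) by ring.
have x3 : x ^+ 3 <= x ^+ 2 by rewrite [x ^+ 3]exprSr ler_piMr ?sqr_ge0//; lra.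
rewrite mulr_ge0//; lra.
Qed.

(* The factor 120 is the one in [sextic_ge]: it makes [a x^2] a lower barrier. *)
Lemma square_barriers (R : realType) (n tau a b C : R) :
  0 <= tau < 1 -> 0 <= C -> 0 < a -> a <= b -> C / (1 - tau) <= b ->
  (forall x h : R, 0 < x <= 1 -> a * x ^+ 2 <= h <= b * x ^+ 2 ->
    120 * a * x ^+ 2 <= h `^ (1 - n) <= C * x `^ (- tau)) ->
  exists g : R -> 'cV[R]_4, connecting_orbit n 0 g.
Proof.
move=> t01 C0 a0 ab Cb hC.
have cs (c : R) : continuous (fun x : R => c * x ^+ 2).
  by move=> x; apply: cvgM; [exact: cvg_cst|exact: exprn_continuous].
have mM (x : R) : 0 < x <= 1 -> 0 < a * x ^+ 2 <= b * x ^+ 2.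
  move=> /andP[x0 _]; rewrite mulr_gt0 ?exprn_gt0//=.
  by rewrite ler_wpM2r ?sqr_ge0.
apply: (@clamped_orbit R n 0 1 tau C (fun x => a * x ^+ 2)
  (fun x => b * x ^+ 2)) => //; first lra.
- move=> x h x01 /(hC x h x01)/andP[_].
  by rewrite subrr powRr0 mulr1.
(* The upper barrier follows from the integral bound with rho = 1, the lower one from comparison
   with 120 a [sextic]. *)
- move=> H v q Hb D H0 v0 v1 x x01; apply/andP; split; last first.
    have [|_] := andP (Hb x _); first lra.
    rewrite mul0r subr0 powRr1; last lra.
    by rewrite -mulrA -expr2 => /le_trans; apply; rewrite ler_wpM2r ?sqr_ge0.
  have h := @sextic_comparison R (120 * a) H v q _ D H0 v0 v1.
  apply: le_trans (h _ x x01).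
    have -> : a * x ^+ 2 = 120 * a * (x ^+ 2 / 120) by field.
    by rewrite ler_pM2l ?sextic_ge// mulr_gt0.
  move=> y y01; rewrite /clamped_rhs mulrCA ler_wpM2l//; first lra.
  have y01' : 0 < y <= 1 by lra.
  have /andP[_ ab'] := mM y y01'.
  have [|//] := andP (hC y (Num.min (Num.max (H y) (a * y ^+ 2)) (b * y ^+ 2)) y01' _).
  by rewrite le_min le_max lexx orbT ab' ge_min lexx orbT.
Qed.

Lemma orbit_exists_zero (R : realType) (n : R) : 0 < n < 3 / 2 ->
  exists g : R -> 'cV[R]_4, connecting_orbit n 0 g.
Proof.
move=> /andP[n0 n32].
have xsq (x : R) : 0 < x <= 1 -> 0 < x ^+ 2 <= 1.
  by move=> /andP[x0 x1]; rewrite exprn_gt0//= expr_le1// ltW.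
have [n1|n1] := ltP n 1.
  (* This a solves 120 a = a^(1 - n), so h >= a x^2 gives h^(1 - n) >= 120 a x^(2 (1 - n)) >= 120 a
     x^2. *)
  pose a : R := (120^-1) `^ n^-1.
  have a0 : 0 < a by apply: powR_gt0; lra.
  have an : 120 * a `^ n = 1 by rewrite /a -powRrM mulVf ?gt_eqF// powRr1; lra.
  have a1 : a <= 1.
    have : a <= 1 `^ n^-1 by apply: ge0_ler_powR; rewrite ?nnegrE ?invr_ge0//; lra.
    by rewrite powR1.
  apply: (@square_barriers R n 0 a 1 1) => //; [lra|by rewrite subr0 divr1|].
  move=> x h x01; rewrite mul1r => /andP[h1 h2].
  have /andP[s0 s1] := xsq x x01.
  have h0 : 0 < h by apply: lt_le_trans h1; exact: mulr_gt0.
  rewrite oppr0 powRr0 mulr1; apply/andP; split; last first.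
    have : h `^ (1 - n) <= 1 `^ (1 - n).
      by apply: ge0_ler_powR; rewrite ?nnegrE//; lra.
    by rewrite powR1.
  apply: (@le_trans _ _ ((a * x ^+ 2) `^ (1 - n))); last first.
    by apply: ge0_ler_powR; rewrite ?nnegrE ?mulr_ge0 ?(ltW a0) ?(ltW s0) ?(ltW h0)//; lra.
  rewrite powRM ?(ltW a0) ?(ltW s0)//.
  have e : 120 * a = a `^ (1 - n).
    have : a `^ (1 - n) * a `^ n = a
      by rewrite -powRD ?(gt_eqF a0) ?implybT// subrK powRr1// ltW.
    by move=> {1}<-; rewrite mulrCA an mulr1.
  rewrite e ler_pM2l ?powR_gt0//.
  by apply: ger1_powR; [rewrite s0|lra].
pose al := n - 1.
(* Here k = 1 - tau with tau = 2 [al]. The lower barrier a x^2 gives h^(-al) <= C x^(-tau) with C =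
   a^(-al), which forces b >= C / k; a is then chosen so that sqrt a = k / 120. *)
pose k := 1 - 2 * al.
have k0 : 0 < k <= 1 by rewrite /k /al; lra.
pose a := (k / 120) ^+ 2.
have a0 : 0 < a by rewrite exprn_gt0//; lra.
have a1 : a <= 1 by rewrite expr_le1//; lra.
pose C := a `^ (- al).
have C1 : 1 <= C.
  rewrite -(powRr0 a); apply: ger_powR; first by rewrite a0.
  by rewrite oppr_le0 /al; lra.
pose b := C / k.
have b1 : C <= b by rewrite ler_pdivlMr ?ler_piMr//; lra.
have b0 : 0 < b by lra.
apply: (@square_barriers R n (2 * al) a b C) => //; [rewrite /al; lra|lra|lra|].
move=> x h x01 /andP[h1 h2].
have /andP[s0 s1] := xsq x x01; have /andP[x0 x1] := x01.
have h0 : 0 < h by apply: lt_le_trans h1; exact: mulr_gt0.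
have -> : 1 - n = - al by rewrite /al; ring.
have al0 : - al <= 0 by rewrite /al; lra.
apply/andP; split; last first.
  have -> : - (2 * al) = 2 * (- al) by ring.
  rewrite powRrM powR_mulrn ?(ltW x0)// -powRM ?(ltW a0) ?(ltW s0)//.
  by apply: le0_ler_powR => //; exact: mulr_gt0.
apply: (@le_trans _ _ (b `^ (- al))); last first.
  apply: le0_ler_powR => //; apply: le_trans h2 _.
  by rewrite ler_piMr// ltW.
apply: (@le_trans _ _ (120 * a)).
  by rewrite ler_piMr// mulr_ge0// ltW.
(* b^-al = a^(al^2) k^al >= a^(1/2) k = 120 a *)
have -> : b `^ (- al) = a `^ (al * al) * k `^ al.
  rewrite /b powRM ?invr_ge0 ?powR_ge0//; last lra.
  rewrite /C -powRrM mulrNN; congr (_ * _).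
  by rewrite -powR_inv1 -?powRrM ?mulN1r ?opprK; lra.
have -> : 120 * a = a `^ (1 / 2) * k.
  have -> : a `^ (1 / 2) = k / 120.
    by rewrite /a mul1r powR12_sqrt ?sqr_ge0// sqrtr_sqr ger0_norm//; lra.
  by rewrite /a; field.
apply: ler_pM; rewrite ?powR_ge0//; first lra.
  by apply: ger_powR; [rewrite a0|rewrite /al; nra].
by apply: ger1_powR; rewrite ?k0// /al; lra.
Qed.

(** * Orbits as solutions *)

Lemma orbit_profile (R : realType) (n theta : R) (g : R -> 'cV[R]_4) :
  connecting_orbit n theta g ->
  profile n (fun t => coord_H (g t)) (fun t => coord_dH (g t)) (fun t => coord_ddH (g t)).
Proof.
move=> [[H0 dg _] gx _ _] x x01.
have d (i : 'I_4) := is_derive_coord i 0 (dg x x01).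
have gxx : coord_x (g x) = x by apply: gx; lra.
split; first exact: H0.
- by have := d 1; rewrite mxE.
- by have := d 2; rewrite mxE.
- by have := d 3; rewrite mxE /= gxx.
Qed.

Lemma orbit_left_cvg (R : realType) (n theta : R) (g : R -> 'cV[R]_4) (i : 'I_4) :
  connecting_orbit n theta g -> g t i 0 @[t --> 1^'-] --> g 1 i 0.
Proof.
move=> [[_ _ g1] _ _ _].
apply: (@left_derivable_cvg R (fun t => g t i 0) (vector_field n (g 1) i 0)).
have := cvg_comp _ _ g1 (@coord_continuous _ _ _ i 0 (vector_field n (g 1))).
by apply: cvg_trans; apply: near_eq_cvg; apply: nearW => h /=; rewrite !mxE.
Qed.

Lemma orbit_flat_ends (R : realType) (n : R) (g : R -> 'cV[R]_4) :
  connecting_orbit n 0 g -> flat_ends (fun t => coord_H (g t)) (fun t => coord_dH (g t)).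
Proof.
move=> og; have [_ _ [_ H0 v0] [_ v1]] := og; split=> //.
by rewrite -v1; exact: orbit_left_cvg og.
Qed.

(** Supplies the upper bound on the height that [profile_unique] requires. *)
Lemma orbit_le_end (R : realType) (n : R) (g : R -> 'cV[R]_4) :
  connecting_orbit n 0 g -> forall x : R, 0 < x < 1 -> coord_H (g x) <= coord_H (g 1).
Proof.
move=> og x /andP[x0 x1]; have pr := orbit_profile og.
have vgt0 := profile_slope_gt0 pr (orbit_flat_ends og).
have dH (z : R) : 0 < z < 1 -> is_derive z 1 (fun t => coord_H (g t)) (coord_dH (g z)).
  by case/pr.
have Hmono := nondecreasing_oo dH (fun x h => ltW (vgt0 x h)).
have H1 : coord_H (g t) @[t --> 1^'-] --> coord_H (g 1) by exact: orbit_left_cvg og.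
apply: (cvgr_to_ge H1); near=> t; apply: Hmono => //.
by near: t; exact: nbhs_left_ge.
Unshelve. all: by end_near. Qed.

Lemma is_derive_unique_oo (R : realType) (f g df dg : R -> R) :
  (forall x : R, 0 < x < 1 -> is_derive x 1 f (df x)) ->
  (forall x : R, 0 < x < 1 -> is_derive x 1 g (dg x)) ->
  (forall x : R, 0 < x < 1 -> f x = g x) -> forall x : R, 0 < x < 1 -> df x = dg x.
Proof.
move=> Df Dg fg x x01; have [_ <-] := Df x x01; have [_ <-] := Dg x x01.
apply: near_eq_derive.
have : x \in `]0, 1[ by rewrite in_itv.
by move=> /near_in_itvoo; apply: filterS => y; rewrite in_itv/= => /fg.
Qed.

(** Equality of the heights on ]0, 1[ passes to the slopes and curvatures by differentiation, and to
    the endpoint 1 by left continuity of every coordinate. *)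
Lemma orbit_unique (R : realType) (n : R) (g g' : R -> 'cV[R]_4) : 0 < n < 3 / 2 ->
  connecting_orbit n 0 g -> connecting_orbit n 0 g' ->
  forall x : R, 0 < x <= 1 -> g' x = g x.
Proof.
move=> n32 og og'; have pr := orbit_profile og; have pr' := orbit_profile og'.
pose B := Num.max (coord_H (g 1)) (coord_H (g' 1)).
have gB (x : R) : 0 < x < 1 -> coord_H (g x) <= B.
  by move=> x01; rewrite le_max (orbit_le_end og).
have gB' (x : R) : 0 < x < 1 -> coord_H (g' x) <= B.
  by move=> x01; rewrite le_max (orbit_le_end og')// orbT.
have eH := profile_unique n32 pr' (orbit_flat_ends og') gB' pr (orbit_flat_ends og) gB.
have ev : forall x : R, 0 < x < 1 -> coord_dH (g' x) = coord_dH (g x).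
  by apply: is_derive_unique_oo eH => x; [case/pr'|case/pr].
have eq : forall x : R, 0 < x < 1 -> coord_ddH (g' x) = coord_ddH (g x).
  by apply: is_derive_unique_oo ev => x; [case/pr'|case/pr].
have ex (x : R) : 0 < x < 1 -> coord_x (g' x) = coord_x (g x).
  by move=> x01; have [_ gx _ _] := og; have [_ gx' _ _] := og'; rewrite gx ?gx'//; lra.
have e (x : R) (i : 'I_4) : 0 < x < 1 -> g' x i 0 = g x i 0.
  move=> x01; have [i0|i0] := eqVneq i 0; first by rewrite i0; exact: ex.
  have [i1|i1] := eqVneq i 1; first by rewrite i1; exact: eH.
  have [i2|i2] := eqVneq i 2; first by rewrite i2; exact: ev.
  suff -> : i = 3 by exact: eq.
  by apply/val_inj; move: i0 i1 i2; rewrite -!val_eqE; case: i => -[|[|[|[|]]]].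
move=> x /andP[x0]; rewrite le_eqVlt => /predU1P[->|x1]; apply/colP => i; last first.
  by apply: e; rewrite x0.
have c := @orbit_left_cvg _ _ _ _ i og; have c' := @orbit_left_cvg _ _ _ _ i og'.
apply: (@cvg_unique _ _ (g' t i 0 @[t --> 1^'-])) c' _ => //.
apply: cvg_trans c; apply: near_eq_cvg; near=> t; apply/esym/e.
by apply/andP; split => //; near: t; exact: nbhs_left_gt.
Unshelve. all: by end_near. Qed.

Unset Implicit Arguments.

Theorem proposition5p4 (R : realType) (n theta : R)
    (hn : (theta = 0 /\ 0 < n < 3 / 2) \/ (0 < theta /\ 0 < n < 3)) :
  (exists g : R -> 'cV[R]_4, connecting_orbit n theta g) /\
  (theta = 0 -> forall g : R -> 'cV[R]_4,
     connecting_orbit n theta g -> positive_orbit g ->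
     (forall g' : R -> 'cV[R]_4,
        connecting_orbit n theta g' -> positive_orbit g' ->
        forall x : R, 0 < x <= 1 -> g' x = g x) /\
     (forall x : R, 0 < x < 1 -> 0 < coord_dH (g x))).
Proof.
split.
  case: hn => [[-> n32]|[th0 n3]]; first exact: orbit_exists_zero.
  exact: orbit_exists_pos.
move=> th0; case: hn => [[_ n32]|[]]; last by rewrite th0 ltxx.
rewrite {}th0 => g og _; split=> [g' og' _|]; first exact: (orbit_unique n32 og og').
exact: profile_slope_gt0 (orbit_profile og) (orbit_flat_ends og).
Qed.
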